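(* Let $r>0$, $\sigma>0$, $\varepsilon\in(0,1)$ and $(u,v)\in\mathbb{R}^2$. Let $I$ be a Gaussian white noise on $\mathbb{R}^2$ of variance $\sigma^2$ and let $s(\varepsilon)$ be the threshold value, i.e. the smallest $s\ge 0$ such that $$\mathbb{P}\bigl(\|\nabla_r I(u,v)\|\ge s\bigm|\Delta_r I(u,v)=0\bigr)\le\varepsilon.$$ Then $$s(\varepsilon)=\sqrt{-\frac{2\sigma^2}{b(r)}\ln\varepsilon}.$$
   Context: $B_r$ is the Euclidean ball of radius $r$ centered at the origin of $\mathbb{R}^2$. For $i,j\in\mathbb{N}$, $b_{ij}(r)=\int_{B_r}x^iy^j\,dx\,dy$, and $$b(r)=b_{20}(r),\qquad \alpha(r)=-\frac{2b_{20}(r)}{b_{00}(r)},\qquad \beta(r)=\frac12\left(b_{40}(r)+b_{22}(r)-\frac{2b_{20}^2(r)}{b_{00}(r)}\right).$$ A Gaussian white noise on $\mathbb{R}^2$ of variance $\sigma^2$ is a random function $W$ on Borel sets $A$ of finite Lebesgue measure $|A|$ such that $W(A)$ is Gaussian with mean $0$ and variance $\sigma^2|A|$, and, for $A_1\cap A_2=\emptyset$, $W(A_1),W(A_2)$ are independent and $W(A_1\cup A_2)=W(A_1)+W(A_2)$. The associated Wiener integral, written $\int h(s,t)\dot B(s,t)\,ds\,dt$ for $h\in L^2(\mathbb{R}^2)$, is linear in $h$ (almost surely), agrees with $W(A)$ when $h$ is the indicator of $A$, and is such that for all $h_1,h_2\in L^2(\mathbb{R}^2)$ the pair $\left(\int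 h_1\dot B,\int h_2\dot B\right)$ is a centered Gaussian vector with covariance $\sigma^2\int h_1h_2$. Saying that $I$ is a Gaussian white noise means $I=\dot B$; then $\nabla_r I=\left(\frac{\partial_r I}{\partial x},\frac{\partial_r I}{\partial y}\right)$ and $\Delta_r I$ are the Wiener integrals $$\frac{\partial_r I}{\partial x}(u,v)=\frac1{b(r)}\int_{B_r}x\,\dot B(u+x,v+y)\,dx\,dy,\qquad \frac{\partial_r I}{\partial y}(u,v)=\frac1{b(r)}\int_{B_r}y\,\dot B(u+x,v+y)\,dx\,dy,$$ $$\Delta_r I(u,v)=\frac1{\beta(r)}\int_{B_r}\dot B(u+x,v+y)\left(\alpha(r)+x^2+y^2\right)dx\,dy,$$ where $\int_{B_r}k(x,y)\dot B(u+x,v+y)\,dx\,dy$ means the Wiener integral of $(s,t)\mapsto k(s-u,t-v)\mathbf 1_{B_r}(s-u,t-v)$. The norm $\|\cdot\|$ is Euclidean. Conditioning on $\{\Delta_r I=0\}$ means: the regular conditional law given $\Delta_r I=t$, in its version that is (weakly) continuous in $t$, evaluated at $t=0$. *)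

(* Defs.v *)
From HB Require Import structures.
From mathcomp Require Import all_boot all_order all_algebra.
From mathcomp Require Import all_classical all_reals all_analysis.

Set Implicit Arguments.
Unset Strict Implicit.
Unset Printing Implicit Defensive.

Import Order.TTheory GRing.Theory Num.Theory.
Import numFieldNormedType.Exports.

Local Open Scope classical_set_scope.
Local Open Scope ring_scope.

Section plane.
Context {R : realType}.

Definition leb2 := (@lebesgue_measure R \x @lebesgue_measure R)%E.

(* The library norm on the product type [R * R] is the sup norm. *)
Definition enorm (z : R * R) : R := Num.sqrt (z.1 ^+ 2 + z.2 ^+ 2).

Definition disc (r : R) : set (R * R) := [set z | enorm z <= r].

Definition moment (i j : nat) (r : R) : R :=
  \int[leb2]_(z in disc r) (z.1 ^+ i * z.2 ^+ j).

Definition bcoef (r : R) : R := moment 2 0 r.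

Definition alpha (r : R) : R := - (2 * moment 2 0 r) / moment 0 0 r.

Definition beta (r : R) : R :=
  2^-1 * (moment 4 0 r + moment 2 2 r - 2 * moment 2 0 r ^+ 2 / moment 0 0 r).

(* The kernel [k], cut off to [disc r], recentred at [(u, v)]. *)
Definition window (r u v : R) (k : R * R -> R) : R * R -> R :=
  fun z => k (z.1 - u, z.2 - v) * \1_(disc r) (z.1 - u, z.2 - v).

End plane.

Section gaussian.
Context {R : realType}.

(* [normal_prob m 0] is not a point mass, so variance 0 is treated apart. *)
Definition gaussian_law (m var : R) : set R -> \bar R :=
  if var == 0 then dirac m else normal_prob m (Num.sqrt var).

Context d {T : measurableType d} (P : probability T R).

Definition is_gaussian (X : {mfun T >-> R}) (m var : R) : Prop :=
  0 <= var /\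
  forall U, measurable U -> distribution P X U = gaussian_law m var U.

Definition centered_gaussian_pair (X Y : {mfun T >-> R}) : Prop :=
  forall a b : R, exists var : R, is_gaussian (a *: X + b *: Y) 0 var.

Definition independent_RV (X Y : {mfun T >-> R}) : Prop :=
  forall U V, measurable U -> measurable V ->
  (P (X @^-1` U `&` Y @^-1` V) = distribution P X U * distribution P Y V)%E.

End gaussian.

Section white_noise.
Context {R : realType} d {T : measurableType d} (P : probability T R).

Definition finite_area (A : set (R * R)) : Prop :=
  measurable A /\ (leb2 A < +oo)%E.

(* [W] is constrained only on Borel sets of finite area. *)
Record gaussian_white_noise (sigma : R) (W : set (R * R) -> {RV P >-> R}) :
    Prop := {
  noise_gaussian : forall A, finite_area A ->
    is_gaussian P (W A) 0 (sigma ^+ 2 * fine (leb2 A)) ;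
  noise_independent : forall A1 A2, finite_area A1 -> finite_area A2 ->
    A1 `&` A2 = set0 -> independent_RV P (W A1) (W A2) ;
  noise_additive : forall A1 A2, finite_area A1 -> finite_area A2 ->
    A1 `&` A2 = set0 ->
    {ae P, forall w, W (A1 `|` A2) w = W A1 w + W A2 w} }.

(* [J h] is the integral of [h] against the noise; [J] is constrained only on
   square-integrable functions. *)
Record wiener_integral (sigma : R) (W : set (R * R) -> {RV P >-> R})
    (J : (R * R -> R) -> {RV P >-> R}) : Prop := {
  wiener_linear : forall (a b : R) h1 h2,
    h1 \in Lfun leb2 2%:E -> h2 \in Lfun leb2 2%:E ->
    {ae P, forall w,
      J (fun z => a * h1 z + b * h2 z) w = a * J h1 w + b * J h2 w} ;
  wiener_indic : forall A, finite_area A ->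
    {ae P, forall w, J \1_A w = W A w} ;
  wiener_gaussian : forall h1 h2,
    h1 \in Lfun leb2 2%:E -> h2 \in Lfun leb2 2%:E ->
    centered_gaussian_pair P (J h1) (J h2) /\
    covariance P (J h1) (J h2) =
      (sigma ^+ 2 * \int[leb2]_z (h1 z * h2 z))%:E }.

Context (J : (R * R -> R) -> {RV P >-> R}) (r u v : R).

Definition noise_dx : {RV P >-> R} :=
  (bcoef r)^-1 *: (J (window r u v (fun z => z.1)) : {mfun T >-> R}).

Definition noise_dy : {RV P >-> R} :=
  (bcoef r)^-1 *: (J (window r u v (fun z => z.2)) : {mfun T >-> R}).

Definition noise_grad : T -> R * R := fun w => (noise_dx w, noise_dy w).

Definition noise_lapl : {RV P >-> R} :=
  (beta r)^-1 *:
    (J (window r u v (fun z => alpha r + z.1 ^+ 2 + z.2 ^+ 2))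
      : {mfun T >-> R}).

End white_noise.

Section conditioning.
Context {R : realType} d {T : measurableType d} (P : probability T R).

(* [kappa] is a regular conditional law of [Y] given [X], weakly continuous in
   the value of [X]. When the law of [X] has full support, such a [kappa] is
   determined everywhere and not just almost everywhere. *)
Record continuous_cond_law (X : {RV P >-> R}) (Y : T -> R * R)
    (kappa : R.-pker R ~> (R * R)%type) : Prop := {
  cond_law_disintegration : forall A B, measurable A -> measurable B ->
    P (X @^-1` A `&` Y @^-1` B) =
      (\int[distribution P X]_(t in A) kappa t B)%E ;
  cond_law_continuous : forall f : R * R -> R,
    continuous f -> bounded_fun f ->
    continuous (fun t : R => \int[kappa t]_z f z) }.

End conditioning.

Definition is_threshold {R : realType} (Q : set (R * R) -> \bar R) (eps s : R) :
    Prop :=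
  let admissible := [set t : R | 0 <= t /\
    (Q [set z | (t <= enorm z)%R] <= eps%:E)%E] in
  admissible s /\ lbound admissible s.

(* Main.v *)
Require Import Defs.
From HB Require Import structures.
From mathcomp Require Import all_boot all_order all_algebra.
From mathcomp Require Import all_classical all_reals all_analysis.
From mathcomp Require Import measurable_realfun ring lra.
Import Order.TTheory GRing.Theory Num.Theory.
Import numFieldNormedType.Exports.
Local Open Scope classical_set_scope.
Local Open Scope ring_scope.

(** The three kernels alpha + x^2 + y^2, x and y are pairwise orthogonal in
    L^2 of the disc, by the reflection x -> - x and the exchange of x and y,
    and x and y both have squared norm b(r).  A linear combination of the
    Laplacian and of the two partial derivatives is the Wiener integral of
    the same combination of kernels, hence a centered gaussian variable whose
    variance is the sum of the three separate variances.  So the joint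
    characteristic function factors: the Laplacian is independent of the
    gradient, and the partial derivatives are independent normal variables of
    variance q = sigma^2 / b(r) ([noise_independent_grad]).

    Consequently the constant kernel, equal to the law nu of the gradient, is
    a continuous conditional law.  Conversely let kappa be any such kernel.
    The Laplacian charges every neighbourhood of 0, so the integral of a
    continuous function against kappa 0 is the limit of its averages over the
    event that the Laplacian is near 0, and by independence these averages
    are computed with nu.  Ramps between two radii then compare the tail of
    the norm under kappa 0 with its tail under nu ([cond_law_sandwich]).
    Under nu the norm has the Rayleigh tail exp (- t^2 / (2 q))
    ([gaussian_pair_tail]), a continuous decreasing function of t that takes
    the value eps exactly at sqrt (- 2 q ln eps).

    Two classical ingredients are proved on the way.

    - A finite measure is determined by its integrals of the waves
      1 + cos (t x + th) ([ripples_determining]).  These waves replace complex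
      exponentials: being bounded and nonnegative, they can be integrated and
      permuted by Tonelli's theorem alone.  Averaging them against
      exp (- t) dt produces Cauchy bumps 1 / (1 + k^2 (x - y)^2); integrating
      these in y produces differences of arctangents, which tend to the
      indicator of an interval as k grows.

    - The Rayleigh tail is obtained without polar coordinates.  The planar
      normal density is a superposition of indicators of discs, because
      exp (- l s) is the integral of l exp (- l u) over u >= s, and the area
      of a disc scales like the square of its radius.  This leaves a constant
      factor which is found by letting t = 0, the total mass being 1
      ([normal2_tail]).  The variance of the normal law follows. *)

Set Implicit Arguments.
Unset Strict Implicit.
Unset Printing Implicit Defensive.

(** * Integration against images of measures *)

Section weighted_image.
Context d d' (T : measurableType d) (S : measurableType d') (R : realType).
Local Open Scope ereal_scope.
Import HBNNSimple.

(** Transport formula for the image by [phi] of the measure of density [g].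
    Taking [g] constant covers plain images, and [phi] the identity covers
    densities; allowing both at once also moves integrals between two
    measurable structures on the same set. *)
Lemma ge0_integral_weighted_image (m : {measure set T -> \bar R})
    (nu : {measure set S -> \bar R}) (phi : T -> S) (g : T -> R)
    (f : S -> \bar R) :
  measurable_fun [set: T] phi ->
  measurable_fun [set: T] g -> (forall x, (0 <= g x)%R) ->
  (forall B, measurable B -> nu B = \int[m]_(x in phi @^-1` B) (g x)%:E) ->
  measurable_fun [set: S] f -> (forall y, 0 <= f y) ->
  \int[nu]_y f y = \int[m]_x (f (phi x) * (g x)%:E).
Proof.
move=> mphi mg g0 nuE mf f0.
have mEg : measurable_fun [set: T] (EFin \o g) by exact/measurable_EFinP.
pose f_ := nnsfun_approx measurableT mf.
have f_cvg y : (f_ n y)%:E @[n --> \oo] --> f y.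
  by apply: cvg_nnsfun_approx => // *; exact: f0.
have nd_f y : nondecreasing_seq (fun n => (f_ n y)%:E).
  by move=> i j ij; rewrite lee_fin; exact/lefP/nd_nnsfun_approx.
transitivity (limn (fun n => \int[nu]_y (f_ n y)%:E)).
  rewrite -monotone_convergence//.
  - by apply: eq_integral => y _; apply/esym/cvg_lim.
  - by move=> n; exact/measurable_EFinP/measurable_funP.
  - by move=> n y _; rewrite lee_fin.
transitivity (limn (fun n => \int[m]_x ((f_ n (phi x))%:E * (g x)%:E))); last first.
  rewrite -monotone_convergence//.
  - by apply: eq_integral => x _; apply/cvg_lim => //; exact: cvgeZr.
  - move=> n; apply: emeasurable_funM => //.
    by apply/measurable_EFinP; exact: measurableT_comp.
  - by move=> n x _; rewrite mule_ge0// lee_fin.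
  - by move=> x _ i j ij; rewrite lee_wpmul2r ?lee_fin//; exact: nd_f.
congr (limn _); apply/funext => n.
rewrite integralT_nnsfun sintegralE.
under [RHS]eq_integral.
  move=> x _; rewrite fimfunE -fsumEFin// ge0_mule_fsuml; last first.
    by move=> r; rewrite nnfun_muleindic_ge0.
  over.
have mpre r : measurable (f_ n @^-1` [set r]) by exact: measurable_funPTI.
have mphir r : measurable (phi @^-1` (f_ n @^-1` [set r])).
  by rewrite -[X in measurable X]setTI; exact: mphi.
rewrite ge0_integral_fsum//.
- apply: eq_fsbigr => r _.
  have [r0|r0] := leP 0%R r; last first.
    rewrite preimage_nnfun0// measure0 mule0.
    by rewrite integral0_eq// => x _; rewrite indicE in_set0 mulr0 mul0e.
  rewrite nuE// integral_mkcond/=.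
  rewrite -ge0_integralZl//.
  + apply: eq_integral => x _; rewrite EFinM -muleA; congr (_ * _).
    rewrite patchE indicE.
    have -> : (phi x \in f_ n @^-1` [set r]) = (x \in phi @^-1` (f_ n @^-1` [set r])).
      by [].
    by case: ifPn => _; rewrite ?mul1e ?mul0e.
  + exact/(measurable_restrictT _ _).1/measurable_funTS.
  + by move=> x _; rewrite erestrict_ge0// => y; rewrite lee_fin.
- move=> r; apply: emeasurable_funM => //.
  apply/measurable_EFinP/measurable_funM => //.
  exact: (@measurableT_comp _ _ _ _ _ _ (\1_(f_ n @^-1` [set r]) : S -> R)).
- move=> r x _; rewrite mule_ge0 ?lee_fin//.
  by have := nnfun_muleindic_ge0 (f_ n) r (phi x); rewrite -EFinM lee_fin.
Qed.

Variables (m : {finite_measure set T -> \bar R}) (phi : T -> S) (g : T -> R)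
  (M : R).
Hypotheses (mphi : measurable_fun [set: T] phi)
  (mg : measurable_fun [set: T] g) (g0 : forall x, (0 <= g x <= M)%R).

(** The hypotheses are arguments so that the measure structure can be attached
    to this function. *)
Definition weighted_image & measurable_fun [set: T] phi &
    measurable_fun [set: T] g & (forall x, (0 <= g x <= M)%R) :=
  fun B : set S => \int[m]_(x in phi @^-1` B) (g x)%:E.

Local Notation wi := (weighted_image mphi mg g0).

Let wi0 : wi set0 = 0.
Proof. by rewrite /weighted_image preimage_set0 integral_set0. Qed.

Let wi_ge0 B : 0 <= wi B.
Proof.
by apply: integral_ge0 => x _; rewrite lee_fin; case/andP: (g0 x).
Qed.

Let mphiT B : measurable B -> measurable (phi @^-1` B).
Proof. by move=> mB; rewrite -[X in measurable X]setTI; exact: mphi. Qed.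

Let wi_sigma_additive : semi_sigma_additive wi.
Proof.
move=> F mF tF mUF; rewrite /weighted_image preimage_bigcup.
rewrite ge0_integral_bigcup//=.
- apply: is_cvg_ereal_nneg_natsum_cond => n _ _; exact: wi_ge0.
- by move=> n; exact: mphiT.
- exact/measurable_funTS/measurable_EFinP.
- by move=> x _; rewrite lee_fin; case/andP: (g0 x).
- apply/trivIsetP => i j _ _ ij; rewrite -preimage_setI.
  by move/trivIsetP : tF => /(_ i j Logic.I Logic.I ij) ->; rewrite preimage_set0.
Qed.

HB.instance Definition _ := isMeasure.Build _ _ _ wi wi0 wi_ge0 wi_sigma_additive.

Let wi_finite : fin_num_fun wi.
Proof.
move=> B mB; rewrite ge0_fin_numE ?wi_ge0//.
apply: (@le_lt_trans _ _ (\int[m]_(x in phi @^-1` B) M%:E)).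
  apply: ge0_le_integral => //.
  - exact: mphiT.
  - by move=> x _; rewrite lee_fin; case/andP: (g0 x).
  - exact/measurable_funTS/measurable_EFinP.
  - by move=> x _; rewrite lee_fin; case/andP: (g0 x).
rewrite integral_cst; last exact: mphiT.
by rewrite ltey_eq fin_numM// fin_num_measure//; exact: mphiT.
Qed.

HB.instance Definition _ := @Measure_isFinite.Build _ _ _ wi wi_finite.

Lemma ge0_integral_weighted_imageE (f : S -> \bar R) :
  measurable_fun [set: S] f -> (forall y, 0 <= f y) ->
  \int[wi]_y f y = \int[m]_x (f (phi x) * (g x)%:E).
Proof.
move=> mf f0; apply: ge0_integral_weighted_image => //.
by move=> x; case/andP: (g0 x).
Qed.

End weighted_image.

Section preserving.
Context d (T : measurableType d) (R : realType) (m : {measure set T -> \bar R}).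
Variable phi : T -> T.
Hypothesis mphi : measurable_fun [set: T] phi.
Hypothesis phi_m : forall A, measurable A -> m (phi @^-1` A) = m A.
Local Open Scope ereal_scope.

Lemma ge0_integral_preserving (f : T -> \bar R) :
  measurable_fun [set: T] f -> (forall x, 0 <= f x) ->
  \int[m]_x f (phi x) = \int[m]_x f x.
Proof.
move=> mf f0.
rewrite [RHS](@ge0_integral_weighted_image _ _ _ _ _ m m phi (cst 1%R))//.
  by apply: eq_integral => x _; rewrite mule1.
move=> A mA; have mpA : measurable (phi @^-1` A).
  by rewrite -[X in measurable X]setTI; exact: mphi.
by rewrite (integral_cst m mpA 1) mul1e phi_m.
Qed.

Lemma integral_preserving (f : T -> \bar R) : measurable_fun [set: T] f ->
  \int[m]_x f (phi x) = \int[m]_x f x.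
Proof.
move=> mf; rewrite -[LHS]/(\int[m]_x (f \o phi) x) integralE [RHS]integralE.
rewrite funepos_comp funeneg_comp.
rewrite -(ge0_integral_preserving (measurable_funepos mf))//.
by rewrite -(ge0_integral_preserving (measurable_funeneg mf)).
Qed.

Lemma Rintegral_preserving (f : T -> R) : measurable_fun [set: T] f ->
  (\int[m]_x f (phi x) = \int[m]_x f x)%R.
Proof.
move=> mf; rewrite /Rintegral (integral_preserving (f := EFin \o f))//.
exact/measurable_EFinP.
Qed.

End preserving.

Section affine.
Context {R : realType}.
(* The copy of the reals whose measurable structure carries Lebesgue measure. *)
Local Notation MR := (measurableTypeR R).
Local Notation mu := (@lebesgue_measure R).
Local Open Scope ereal_scope.

(** Both sides are measures in [A] which agree on intervals. *)
Lemma lebesgue_measure_affine (a b : R) (A : set R) : (0 < a)%R ->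
  measurable A -> a%:E * mu ((fun x => a * x + b)%R @^-1` A) = mu A.
Proof.
move=> a0 mA.
pose phi := (fun x : R => a * x + b)%R : measurableTypeR R -> measurableTypeR R.
have mphi : measurable_fun [set: measurableTypeR R] phi.
  by apply: measurable_funD => //; exact: measurable_funM.
pose Phi : {mfun measurableTypeR R >-> measurableTypeR R} :=
  HB.pack phi (@isMeasurableFun.Build _ _ _ _ phi mphi).
have a0' : (0 <= a)%R by exact: ltW.
apply/esym.
rewrite (@lebesgue_measure_unique _ (mscale (NngNum a0') (pushforward mu Phi)))//.
move=> _ [[x y]] _ <- /=; rewrite /mscale/= /pushforward/=.
have -> : Phi @^-1` `]x, y] = `]((x - b) / a)%R, ((y - b) / a)%R]%classic.
  apply/seteqP; split => z /=; rewrite !in_itv/= /phi ltr_pdivrMr// ler_pdivlMr//;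
    by rewrite ltrBlDr lerBrDr mulrC.
rewrite !lebesgue_measure_itv/= !lte_fin ltr_pM2r ?invr_gt0// ltrD2r.
case: ifPn => // xy; last by rewrite mule0.
rewrite -!EFinD -EFinM; congr EFin; field; exact: lt0r_neq0.
Qed.

Lemma lebesgue_measure_translate (b : R) (A : set R) : measurable A ->
  mu ((fun x => x + b)%R @^-1` A) = mu A.
Proof.
move=> mA; rewrite -(@lebesgue_measure_affine 1 b A)// mul1e.
by under eq_fun do rewrite -[X in (X + b)%R]mul1r.
Qed.

Lemma ge0_integral_translate (b : R) (f : R -> \bar R) :
  measurable_fun [set: R] f -> (forall x, 0 <= f x) ->
  \int[mu]_x f (x + b)%R = \int[mu]_x f x.
Proof.
move=> mf f0; apply: (@ge0_integral_preserving _ (measurableTypeR R) R mu (fun x => x + b)%R) => //.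
  exact: measurable_funD.
by move=> A mA; exact: lebesgue_measure_translate.
Qed.

(** Invariance of area is inherited from products: it suffices to check it on
    rectangles. *)
Lemma leb2_map (phi psi : R -> R) (A : set (R * R)) (a : R) :
  (0 <= a)%R ->
  measurable_fun [set: R] phi -> measurable_fun [set: R] psi ->
  (forall B C, measurable B -> measurable C ->
    a%:E * (mu (phi @^-1` B) * mu (psi @^-1` C)) = mu B * mu C) ->
  measurable A ->
  a%:E * leb2 ((fun z => (phi z.1, psi z.2)) @^-1` A) = leb2 A.
Proof.
move=> a0 mphi mpsi H mA.
pose F := fun z : MR * MR => (phi z.1, psi z.2) : MR * MR.
have mF : measurable_fun [set: MR * MR] F.
  by apply: measurable_fun_pair; [exact: (measurableT_comp mphi)|exact: (measurableT_comp mpsi)].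
pose Phi : {mfun (MR * MR)%type >-> (MR * MR)%type} :=
  HB.pack F (@isMeasurableFun.Build _ _ _ _ F mF).
apply/esym.
rewrite [LHS](@product_measure_unique _ _ _ _ _ mu mu
  (mscale (NngNum a0) (pushforward leb2 Phi)))// => B C mB mC.
rewrite /= /mscale/= -H//; congr (_ * _).
rewrite /pushforward/=.
have -> : Phi @^-1` (B `*` C) = (phi @^-1` B) `*` (psi @^-1` C) by [].
have mpre (h : R -> R) (D : set R) : measurable_fun [set: R] h -> measurable D ->
    measurable (h @^-1` D).
  by move=> mh mD; rewrite -[X in measurable X]setTI; exact: mh.
by rewrite /leb2 product_measure1E//; exact: mpre.
Qed.

Lemma leb2_swap (A : set (R * R)) : measurable A ->
  leb2 (swap_pair @^-1` A) = leb2 A.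
Proof.
move=> mA; pose F := @swap_pair MR MR.
have mF : measurable_fun [set: MR * MR] F by exact: measurable_fun_pair.
pose Phi : {mfun (MR * MR)%type >-> (MR * MR)%type} :=
  HB.pack F (@isMeasurableFun.Build _ _ _ _ F mF).
apply/esym.
rewrite [LHS](@product_measure_unique _ _ _ _ _ mu mu (pushforward leb2 Phi))//.
move=> B C mB mC; rewrite /= /pushforward/=.
have -> : Phi @^-1` (B `*` C) = C `*` B by apply/seteqP; split => -[x y] [].
by rewrite /leb2 product_measure1E// muleC.
Qed.

End affine.

(** * Cosine waves determine a finite measure *)

Section derivatives.
Context {R : realType}.
Implicit Types (f g : R -> R) (y t a b c : R).

Lemma is_derive1M f g t a b : is_derive t (1 : R) f a -> is_derive t (1 : R) g b ->
  is_derive t (1 : R) (fun s => f s * g s) (a * g t + f t * b).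
Proof.
move=> df dg; rewrite -[X in is_derive _ _ X _]/(f * g); apply: is_derive_eq.
by rewrite /GRing.scale/= addrC [g t * _]mulrC.
Qed.

Lemma is_derive1D f g t a b : is_derive t (1 : R) f a -> is_derive t (1 : R) g b ->
  is_derive t (1 : R) (fun s => f s + g s) (a + b).
Proof. by move=> df dg; exact: is_deriveD. Qed.

Lemma is_derive1_affine y c t : is_derive t (1 : R) (fun s => y * s + c) y.
Proof.
have H := is_derive1D (is_derive1M (is_derive_cst y t (1 : R))
  (is_derive_id t (1 : R))) (is_derive_cst c t (1 : R)).
by apply: (is_derive_eq H); rewrite mul0r add0r mulr1 addr0.
Qed.

Lemma is_derive1_continuous f (df : R -> R) :
  (forall t, is_derive t (1 : R) f (df t)) -> continuous f.
Proof.
move=> H t; apply: differentiable_continuous; apply/derivable1_diffP.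
by have := H t => ?; exact: ex_derive.
Qed.

End derivatives.

Section rcos.
Context {R : realType}.
Implicit Types a b : R.

(** The raised cosine stands for the exponential of an imaginary number: it is
    nonnegative, and its phase shifts give both the cosine and the sine. *)
Definition rcos a : R := 1 + cos a.

Lemma rcos_ge0 a : 0 <= rcos a.
Proof. by rewrite /rcos -lerBlDl sub0r cos_geN1. Qed.

Lemma rcos_le2 a : rcos a <= 2.
Proof. by rewrite /rcos; have := cos_le1 a; lra. Qed.

Lemma continuous_rcos : continuous rcos.
Proof. by move=> x; apply: cvgD; [exact: cvg_cst|exact: continuous_cos]. Qed.

Lemma measurable_rcos : measurable_fun [set: R] rcos.
Proof. by apply: continuous_measurable_fun; exact: continuous_rcos. Qed.

(** The addition formula in a form where every term is nonnegative, so that it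
    can be integrated in the extended reals. *)
Lemma rcosM a b :
  rcos a * rcos b + 2 = rcos a + rcos b + 2^-1 * rcos (a + b) + 2^-1 * rcos (a - b).
Proof. rewrite /rcos cosD cosB; lra. Qed.

Context d (T : measurableType d) (m : {finite_measure set T -> \bar R}).
Local Open Scope ereal_scope.

(** Integrals of products of waves reduce to integrals of single waves. *)
Lemma integral_rcosM (f g : T -> R) :
  measurable_fun [set: T] f -> measurable_fun [set: T] g ->
  \int[m]_x (rcos (f x) * rcos (g x))%:E + 2%:E * m setT =
  \int[m]_x (rcos (f x))%:E + \int[m]_x (rcos (g x))%:E +
  (2^-1)%:E * \int[m]_x (rcos (f x + g x))%:E +
  (2^-1)%:E * \int[m]_x (rcos (f x - g x))%:E.
Proof.
move=> mf mg.
have mr h : measurable_fun [set: T] h -> measurable_fun [set: T] (fun x => (rcos (h x))%:E).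
  by move=> mh; apply/measurable_EFinP; exact: (measurableT_comp measurable_rcos).
have r0 a : 0 <= (rcos a)%:E by rewrite lee_fin rcos_ge0.
have mD : measurable_fun [set: T] (fun x => (f x + g x)%R) by exact: measurable_funD.
have mB : measurable_fun [set: T] (fun x => (f x - g x)%R) by exact: measurable_funB.
have h0 : 0 <= (2^-1 : R)%:E by rewrite lee_fin.
have [mrf mrg mrD mrB] := And4 (mr _ mf) (mr _ mg) (mr _ mD) (mr _ mB).
have mrM : measurable_fun [set: T] (fun x => (rcos (f x) * rcos (g x))%:E).
  by apply/measurable_EFinP/measurable_funM; apply: (measurableT_comp measurable_rcos).
have mZ (h : T -> \bar R) : measurable_fun [set: T] h -> measurable_fun [set: T] (fun x => (2^-1)%:E * h x).
  by move=> mh; apply: emeasurable_funM.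
rewrite -(integral_cst m measurableT 2%:E) -!ge0_integralZl//.
rewrite -!ge0_integralD//=.
- by apply: eq_integral => x _; rewrite -!EFinM -!EFinD rcosM.
- by move=> x _; rewrite !adde_ge0 ?mule_ge0.
- by apply: emeasurable_funD; [exact: emeasurable_funD|exact: mZ].
- by move=> x _; rewrite mule_ge0.
- exact: mZ.
- by move=> x _; rewrite adde_ge0.
- exact: emeasurable_funD.
- by move=> x _; rewrite mule_ge0.
- exact: mZ.
- by move=> x _; rewrite lee_fin mulr_ge0 ?rcos_ge0.
Qed.

End rcos.

Section fourier.
Context {R : realType}.
Local Notation mu := (@lebesgue_measure R).
Implicit Types (x y t th : R).

Definition ripple t th x := rcos (t * x + th).

Lemma ripple_ge0 t th x : 0 <= ripple t th x.
Proof. exact: rcos_ge0. Qed.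

Lemma ripple_le2 t th x : ripple t th x <= 2.
Proof. exact: rcos_le2. Qed.

Lemma is_derive_ripple t th x :
  is_derive x (1 : R) (ripple t th) (- sin (t * x + th) * t).
Proof.
rewrite /ripple /rcos.
have H := is_derive1D (is_derive_cst (1 : R) x (1 : R))
  (is_derive1_comp (is_derive_cos _) (is_derive1_affine t th x)).
by apply: (is_derive_eq H); rewrite add0r.
Qed.

Lemma measurable_ripple t th : measurable_fun [set: R] (ripple t th).
Proof.
apply: continuous_measurable_fun.
exact: (is_derive1_continuous (is_derive_ripple t th)).
Qed.

(** The Laplace transform of a wave at 1, computed with an explicit
    antiderivative.  As a function of [y] the result is a Cauchy bump. *)
Lemma integral_expR_ripple y :
  (\int[mu]_(t in `[0%R, +oo[) (expR (- t) * ripple y 0 t)%:E =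
   (1 + (1 + y ^+ 2)^-1)%:E)%E.
Proof.
have y1 : 1 <= 1 + y ^+ 2 by rewrite lerDl sqr_ge0.
have y0 : 1 + y ^+ 2 != 0 by rewrite lt0r_neq0// (lt_le_trans _ y1).
have dexp t : is_derive t (1 : R) (fun s => expR (-1 * s + 0)) (- expR (- t)).
  have H := is_derive1_comp (is_derive_expR _) (is_derive1_affine (-1) 0 t).
  by apply: (is_derive_eq H); rewrite mulN1r addr0 mulrN1.
have dsin t : is_derive t (1 : R) (fun s => sin (y * s + 0)) (cos (y * t) * y).
  have H := is_derive1_comp (is_derive_sin _) (is_derive1_affine y 0 t).
  by apply: (is_derive_eq H); rewrite addr0.
have dcos t : is_derive t (1 : R) (fun s => cos (y * s + 0)) (- sin (y * t) * y).
  have H := is_derive1_comp (is_derive_cos _) (is_derive1_affine y 0 t).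
  by apply: (is_derive_eq H); rewrite addr0.
(* The antiderivative of exp (- t) (1 + cos (y t)); the affine arguments are
   those of the chain rule lemmas. *)
pose F t := expR (-1 * t + 0) *
  ((y * sin (y * t + 0) + -1 * cos (y * t + 0)) * (1 + y ^+ 2)^-1 + -1).
have dF t : is_derive t (1 : R) F (expR (- t) * ripple y 0 t).
  have H := is_derive1M (dexp t) (is_derive1D (is_derive1M (is_derive1D
     (is_derive1M (is_derive_cst y t (1 : R)) (dsin t))
     (is_derive1M (is_derive_cst (-1 : R) t (1 : R)) (dcos t)))
     (is_derive_cst (1 + y ^+ 2)^-1 t (1 : R))) (is_derive_cst (-1 : R) t (1 : R))).
  apply: (is_derive_eq H); rewrite /ripple /rcos /cst mulN1r !addr0; field.
  exact: y0.
have cF : continuous F by exact: is_derive1_continuous.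
rewrite (@ge0_continuous_FTC2y _ _ F _ 0).
- rewrite /F !mulr0 addr0 expR0 mul1r sin0 cos0 mulr0 add0r -EFinN.
  by congr EFin; field; exact: y0.
- by move=> x _; rewrite mulr_ge0 ?expR_ge0 ?ripple_ge0.
- apply: continuous_subspaceT => x.
  apply: (@is_derive1_continuous _ (fun t => expR (- t) * ripple y 0 t)
    (fun t => - expR (- t) * ripple y 0 t + expR (- t) * (- sin (y * t + 0) * y))).
  move=> t; have H := is_derive1M (dexp t) (is_derive_ripple y 0 t).
  under eq_fun do rewrite -[X in expR X]addr0 -mulN1r.
  by apply: (is_derive_eq H); rewrite mulN1r addr0.
- have E0 : (`|y| + 2) * expR (- t) @[t --> +oo] --> (0 : R).
    by rewrite -[X in _ --> X](mulr0 (`|y| + 2)); apply: cvgMr; exact: cvgr_expR.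
  have E1 : - ((`|y| + 2) * expR (- t)) @[t --> +oo] --> (0 : R).
    by rewrite -[X in _ --> X]oppr0; apply: cvgN.
  apply: (squeeze_cvgr _ E1 E0); apply: nearW => t.
  rewrite -ler_norml /F mulN1r !addr0 normrM ger0_norm ?expR_ge0// mulrC.
  rewrite ler_wpM2r ?expR_ge0// (le_trans (ler_normD _ _))// normrN1.
  rewrite (_ : `|y| + 2 = `|y| + 1 + 1); last by ring.
  rewrite lerD2r normrM mulN1r.
  rewrite (@ger0_norm _ (_^-1)) ?invr_ge0 ?(le_trans _ y1)//.
  rewrite ler_pdivrMr ?(lt_le_trans _ y1)//.
  rewrite (@le_trans _ _ (`|y| + 1))//.
    rewrite (le_trans (ler_normB _ _))// lerD ?cos_max// normrM.
    by rewrite ler_piMr// sin_max.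
  by rewrite ler_peMr// addr_ge0.
- by move=> x _; have := dF x => ?; exact: ex_derive.
- by apply: cvg_at_right_filter; exact: cF.
- by move=> x _; rewrite derive1E; have := dF x => ?; exact: derive_val.
Qed.

End fourier.

Section cauchy_bumps.
Context {R : realType}.
Local Notation mu := (@lebesgue_measure R).
Implicit Types (x y t th : R).

(** A Cauchy density of scale [1 / k], centered at [y], up to a constant
    factor. *)
Definition bump k y x : R := (1 + (k * (x - y)) ^+ 2)^-1.

Lemma bump_ge0 k y x : 0 <= bump k y x.
Proof. by rewrite invr_ge0 addr_ge0 ?sqr_ge0. Qed.

Lemma measurable_bump2 k : measurable_fun [set: R * R] (fun z => bump k z.2 z.1).
Proof.
apply: (measurableT_comp (f := fun w : R => (1 + w ^+ 2)^-1)).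
  apply: continuous_measurable_fun => w.
  have := @continuous_oneDsqrV R w.
  by rewrite /oneDsqr.
by apply: measurable_funM => //; exact: measurable_funB.
Qed.

Lemma is_derive_atan_affine k c y :
  is_derive y (1 : R) (fun y => atan (k * y + c)) (k / (1 + (k * y + c) ^+ 2)).
Proof.
have H := is_derive1_comp (is_derive1_atan _) (is_derive1_affine k c y).
by apply: (is_derive_eq H); rewrite mulrC.
Qed.

Lemma integral_bump k a b x : 0 < k -> a < b ->
  (\int[mu]_(y in `[a, b]) (k * bump k y x)%:E =
   (atan (k * (b - x)) - atan (k * (a - x)))%:E)%E.
Proof.
move=> k0 ab.
pose F y := atan (k * y + - (k * x)).
have dF y : is_derive y (1 : R) F (k * bump k y x).
  apply: (is_derive_eq (is_derive_atan_affine _ _ _)).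
  by rewrite /bump -mulrBr -[y - x]opprB mulrN sqrrN.
have cF : continuous F by exact: is_derive1_continuous.
rewrite (@continuous_FTC2 _ _ F)//.
- by rewrite /F -!mulrBr.
- apply: continuous_subspaceT => y.
  apply: cvgMr.
  rewrite /bump.
  apply: (@continuous_comp _ _ _ (fun y => k * (x - y)) (fun w => (1 + w ^+ 2)^-1)).
    apply: (@is_derive1_continuous _ (fun y => k * (x - y)) (fun=> - k)) => z.
    have H := is_derive1_affine (- k) (k * x) z.
    suff -> : (fun y => k * (x - y)) = (fun s => - k * s + k * x) by [].
    by apply/funext => s; ring.
  exact: (@continuous_oneDsqrV R).
- split.
  + by move=> y _; have := dF y => ?; exact: ex_derive.
  + by apply: cvg_at_right_filter; exact: cF.
  + by apply: cvg_at_left_filter; exact: cF.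
- by move=> y _; rewrite derive1E; have := dF y => ?; exact: derive_val.
Qed.

Section measure.
Variable m : {finite_measure set R -> \bar R}.

(** The constant 1 is itself a wave, so that waves also determine the total
    mass. *)
Lemma ripple_phase0 : (\int[m]_x (ripple 0 (pi / 2) x)%:E = m setT)%E.
Proof.
rewrite -[RHS]mul1e -(integral_cst m measurableT 1%E).
by apply: eq_integral => x _; rewrite /ripple /rcos mul0r add0r cos_pihalf addr0.
Qed.

(** By Tonelli, the integral of a Cauchy bump is determined by the integrals
    of the waves. *)
Lemma integral_bump_ripple k y :
  (\int[m]_x (1 + bump k y x)%:E =
   \int[mu]_(t in `[0%R, +oo[)
      ((expR (- t))%:E * \int[m]_x (ripple (t * k) (- (t * k * y)) x)%:E))%E.
Proof.
pose h (z : R * R) := expR (- z.2) * ripple (z.2 * k) (- (z.2 * k * y)) z.1.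
have h0 z : 0 <= h z by rewrite mulr_ge0 ?expR_ge0 ?ripple_ge0.
have mh : measurable_fun [set: R * R] h.
  apply: measurable_funM.
    by apply: measurableT_comp => //; exact: measurableT_comp.
  apply: (measurableT_comp measurable_rcos).
  apply: measurable_funD.
    by apply: measurable_funM => //; exact: measurable_funM.
  apply: measurableT_comp => //.
  by apply: measurable_funM => //; exact: measurable_funM.
pose D : set R := `[0, +oo[%classic.
have mD : measurable D by exact: measurable_itv.
pose H (z : R * measurableTypeR R) := ((h z)%:E * (\1_D z.2)%:E)%E.
transitivity (\int[m]_x \int[mu]_t H (x, t))%E.
  apply: eq_integral => x _.
  rewrite /bump -integral_expR_ripple [LHS]integral_mkcond.
  apply: eq_integral => t _; rewrite /H /h patchE indicE /=.
  case: ifPn => _; rewrite ?mule1 ?mule0//.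
  by congr ((_ * _)%:E); rewrite /ripple; congr (rcos _); ring.
rewrite (sfinite_Fubini m mu)//; last 2 first.
- by move=> z; rewrite mule_ge0 ?lee_fin.
- apply: emeasurable_funM; first exact/measurable_EFinP.
  apply/measurable_EFinP.
  apply: (@measurableT_comp _ _ _ _ _ _ (\1_D : measurableTypeR R -> R) _ snd) => //.
rewrite [RHS]integral_mkcond; apply: eq_integral => t _.
rewrite patchE /H /= indicE; case: ifPn => _.
  under eq_integral do rewrite mule1 /h/= EFinM.
  rewrite ge0_integralZl//.
  - by apply/measurable_EFinP; exact: measurable_ripple.
  - by move=> x _; rewrite lee_fin ripple_ge0.
by rewrite integral0_eq// => x _; rewrite mule0.
Qed.

(** By Tonelli again, integrating the bumps in their center gives differences
    of arctangents. *)
Lemma integral_atan_bump k a b : 0 < k -> a < b ->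
  (\int[m]_x (atan (k * (b - x)) - atan (k * (a - x)))%:E =
   \int[mu]_(y in `[a, b]) (k%:E * \int[m]_x (bump k y x)%:E))%E.
Proof.
move=> k0 ab; have k0' := ltW k0.
pose D : set R := `[a, b]%classic.
have mD : measurable D by exact: measurable_itv.
pose H (z : R * measurableTypeR R) := ((k * bump k z.2 z.1)%:E * (\1_D z.2)%:E)%E.
have mb : measurable_fun [set: R * R] (fun z : R * R => k * bump k z.2 z.1).
  by apply: measurable_funM => //; exact: measurable_bump2.
transitivity (\int[m]_x \int[mu]_t H (x, t))%E.
  apply: eq_integral => x _.
  rewrite -integral_bump// [LHS]integral_mkcond.
  apply: eq_integral => t _; rewrite /H patchE indicE /=.
  by case: ifPn => _; rewrite ?mule1 ?mule0.
rewrite (sfinite_Fubini m mu)//; last 2 first.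
- by move=> z; rewrite mule_ge0 ?lee_fin ?mulr_ge0 ?bump_ge0.
- apply: emeasurable_funM; first exact/measurable_EFinP.
  apply/measurable_EFinP.
  apply: (@measurableT_comp _ _ _ _ _ _ (\1_D : measurableTypeR R -> R) _ snd) => //.
rewrite [RHS]integral_mkcond; apply: eq_integral => t _.
rewrite patchE /H /= indicE; case: ifPn => _.
  under eq_integral do rewrite mule1 /= EFinM.
  rewrite ge0_integralZl//.
  - by apply/measurable_EFinP; exact: (measurableT_comp (measurable_bump2 k) (pair2_measurable _)).
  - by move=> x _; rewrite lee_fin bump_ge0.
by rewrite integral0_eq// => x _; rewrite mule0.
Qed.

End measure.
End cauchy_bumps.

(** A class of test functions whose integrals characterize a finite measure. *)
Definition determining d (S : measurableType d) (R : realType)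
    (F : set (S -> R)) :=
  forall m1 m2 : {finite_measure set S -> \bar R},
  (forall f, F f -> (\int[m1]_y (f y)%:E = \int[m2]_y (f y)%:E)%E) ->
  forall B, measurable B -> m1 B = m2 B.

Lemma adde_cancelr (R : numDomainType) (x y z : \bar R) : z \is a fin_num ->
  (x + z = y + z)%E -> x = y.
Proof. by move=> zfin /(congr1 (fun w => w - z)%E); rewrite !addeK. Qed.

Section ripple_determining.
Context {R : realType}.
Local Notation mu := (@lebesgue_measure R).
Implicit Types (x y t th : R).

Lemma cvgNy_atan : (@atan R) x @[x --> -oo] --> - (pi / 2).
Proof.
apply/cvgNy_compNP; under eq_fun do rewrite /= atanN.
by apply: cvgN; exact: cvgy_atan.
Qed.

(** The limit of [atan (k * (c - x))] for large [k], with the value at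
    [x = c] that makes differences into indicators of intervals closed on the
    right. *)
Definition step_atan c x : R := if x <= c then pi / 2 else - (pi / 2).

(** The scale is [n^2] and the jump is shifted to [c + 1 / n]: the argument
    then tends to infinity at [x = c] too, so that the pointwise limit is the
    step that includes [c]. *)
Lemma cvg_step_atan c x :
  atan (n.+1%:R ^+ 2 * (c + n.+1%:R^-1 - x)) @[n --> \oo] --> step_atan c x.
Proof.
pose u n : R := n.+1%:R * (n.+1%:R * (c - x) + 1).
have -> : (fun n => atan (n.+1%:R ^+ 2 * (c + n.+1%:R^-1 - x))) = (@atan R) \o u.
  apply/funext => n /=; congr atan; rewrite /u.
  by field; rewrite addrC natr1 pnatr_eq0.
have uy : x <= c -> u n @[n --> \oo] --> +oo.
  move=> xc; apply/cvgryPge => A; near=> n.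
  apply: (@le_trans _ _ n.+1%:R).
    by apply: (@le_trans _ _ n%:R); [near: n; exact: nbhs_infty_ger|rewrite ler_nat].
  by rewrite ler_peMr// lerDr mulr_ge0// subr_ge0.
have uNy : c < x -> u n @[n --> \oo] --> -oo.
  move=> xc; apply/cvgrNyPle => A; near=> n.
  have cx : 0 < x - c by rewrite subr_gt0.
  have nA : 1 + `|A| <= n.+1%:R * (x - c).
    rewrite -ler_pdivrMr//; apply: (@le_trans _ _ n%:R); last by rewrite ler_nat.
    by near: n; exact: nbhs_infty_ger.
  have n1 : 1 <= n.+1%:R :> R by rewrite ler1n.
  have A0 := normr_ge0 A.
  have AA : - `|A| <= A by rewrite lerNl -normrN ler_norm.
  apply: le_trans AA; rewrite lerNr -mulrN.
  apply: (@le_trans _ _ (1 * (n.+1%:R * (x - c) - 1))); first by rewrite mul1r; lra.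
  rewrite [leRHS](_ : _ = n.+1%:R * (n.+1%:R * (x - c) - 1)); last by ring.
  by rewrite ler_wpM2r// subr_ge0 (le_trans _ nA)// lerDl.
have [xc|xc] := leP x c.
  have -> : step_atan c x = pi / 2 by rewrite /step_atan xc.
  exact: (cvg_comp _ _ (uy xc) (@cvgy_atan R)).
have -> : step_atan c x = - (pi / 2) by rewrite /step_atan leNgt xc.
exact: (cvg_comp _ _ (uNy xc) cvgNy_atan).
Unshelve. all: by end_near.
Qed.

Definition ripples : set (R -> R) := [set f | exists t th, f = ripple t th].

(** Waves give the integrals of the Cauchy bumps, hence of differences of
    arctangents, hence by dominated convergence the measures of half-open
    intervals. *)
Lemma ripples_determining : determining ripples.
Proof.
move=> m1 m2 H.
have H' t th : (\int[m1]_x (ripple t th x)%:E = \int[m2]_x (ripple t th x)%:E)%E.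
  by apply: H; exists t, th.
have mT : m1 setT = m2 setT by rewrite -!ripple_phase0 H'.
have mbk k y : measurable_fun [set: R] (fun x => bump k y x).
  exact: (measurableT_comp (measurable_bump2 k) (pair2_measurable _)).
have E1 k y : (\int[m1]_x (bump k y x)%:E = \int[m2]_x (bump k y x)%:E)%E.
  have : (\int[m1]_x (1 + bump k y x)%:E = \int[m2]_x (1 + bump k y x)%:E)%E.
    by rewrite !integral_bump_ripple; apply: eq_integral => t _; rewrite H'.
  have S (m : {finite_measure set R -> \bar R}) :
      (\int[m]_x (1 + bump k y x)%:E = \int[m]_x (bump k y x)%:E + m setT)%E.
    under eq_integral do rewrite addrC EFinD.
    rewrite ge0_integralD//.
    - by rewrite integral_cst// mul1e.
    - by move=> x _; rewrite lee_fin bump_ge0.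
    - exact/measurable_EFinP.
  by rewrite !S mT; apply: adde_cancelr; exact: fin_num_measure.
(* [A a b n] tends to [pi] times the indicator of the interval from [a],
   excluded, to [b], included. *)
pose A (a b : R) n x := atan (n.+1%:R ^+ 2 * (b + n.+1%:R^-1 - x)) -
                  atan (n.+1%:R ^+ 2 * (a + n.+1%:R^-1 - x)).
have E2 a b n : a < b -> (\int[m1]_x (A a b n x)%:E = \int[m2]_x (A a b n x)%:E)%E.
  move=> ab; rewrite /A !integral_atan_bump ?ltrD2r ?exprn_gt0//.
  by apply: eq_integral => y _; rewrite E1.
have mA a b n : measurable_fun [set: R] (A a b n).
  apply: measurable_funB;
    (apply: (measurableT_comp (continuous_measurable_fun (@continuous_atan R)));
    by apply: measurable_funM => //; exact: measurable_funB).
have E3 (m : {finite_measure set R -> \bar R}) a b : a < b ->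
    (\int[m]_x (A a b n x)%:E @[n --> \oo] --> pi%:E * m `]a, b]%classic)%E.
  move=> ab.
  have -> : (pi%:E * m `]a, b]%classic = \int[m]_x (step_atan b x - step_atan a x)%:E)%E.
    rewrite -[in LHS](setIT `]a, b]%classic) -integral_indic// -ge0_integralZl//.
    - apply: eq_integral => x _; rewrite -EFinM; congr EFin.
      rewrite /step_atan indicE; case: ifPn => [xb|]; case: ifPn => xa.
      + by rewrite memNset ?mulr0 ?subrr//= in_itv/= ltNge xa.
      + rewrite mem_set ?mulr1//= ?in_itv/= ?ltNge ?xa//.
        by rewrite opprK -splitr.
      + by move=> /negP; case; rewrite (le_trans xa)// ltW.
      + by move=> nb; rewrite memNset ?mulr0 ?subrr//= in_itv/= (negbTE nb) andbF.
    - by apply/measurable_EFinP; exact: measurable_indic.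
    - by rewrite lee_fin pi_ge0.
  apply: (@dominated_cvg _ _ _ m _ measurableT _ _ (cst pi%:E)) => //.
  - by move=> n; exact/measurable_EFinP.
  - move=> x _; apply: cvg_EFin; first exact: nearW.
    by apply: cvgB; exact: cvg_step_atan.
  - exact: finite_measure_integrable_cst.
  - move=> n x _; rewrite /= lee_fin ler_norml /A.
    have := atan_ltpi2 (n.+1%:R ^+ 2 * (b + n.+1%:R^-1 - x)).
    have := atan_gtNpi2 (n.+1%:R ^+ 2 * (b + n.+1%:R^-1 - x)).
    have := atan_ltpi2 (n.+1%:R ^+ 2 * (a + n.+1%:R^-1 - x)).
    have := atan_gtNpi2 (n.+1%:R ^+ 2 * (a + n.+1%:R^-1 - x)).
    lra.
have E4 a b : m1 `]a, b]%classic = m2 `]a, b]%classic.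
  have [ba|ab] := leP b a; first by rewrite set_itv_ge ?bnd_simp -?leNgt// !measure0.
  have F : (pi%:E * m1 `]a, b]%classic = pi%:E * m2 `]a, b]%classic)%E.
    have E : (fun n => \int[m1]_x (A a b n x)%:E)%E =
             (fun n => \int[m2]_x (A a b n x)%:E)%E.
      by apply/funext => n; exact: E2.
    apply: (cvg_unique _ (E3 m1 _ _ ab)) => //.
    by rewrite E; exact: E3.
  have := congr1 (fun z => (pi^-1)%:E * z)%E F.
  by rewrite !muleA -EFinM mulVf ?mul1e// gt_eqF// pi_gt0.
move=> B mB.
apply: (measure_unique (@ocitv R) (fun n => `](- n%:R), n%:R]%classic)) => //.
- exact: ocitvI.
- move=> n; exact: is_ocitv.
- apply/seteqP; split => // x _.
  have := truncnS_gt `|x|; rewrite ltr_norml => /andP[x1 x2].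
  by exists (Num.truncn `|x|).+1 => //=; rewrite in_itv/= x1 ltW.
- by move=> _ [[a b] _ <-] /=; exact: E4.
- by move=> n; rewrite -ge0_fin_numE// fin_num_measure.
Qed.

End ripple_determining.

(** Test functions that can serve as densities of finite measures. *)
Definition weights d (S : measurableType d) (R : realType) (F : set (S -> R)) :=
  forall f, F f -> measurable_fun [set: S] f /\
                   exists M, forall y, 0 <= f y <= M.

Section determining_prod.
Context d1 d2 (S1 : measurableType d1) (S2 : measurableType d2) (R : realType).

(** The variables are freed one at a time.  For fixed [g], weighting by
    [g z.2] and projecting to the first factor gives finite measures that the
    first class identifies; the indicator of a measurable [A] then takes the
    role of [g], and the second class identifies the values on rectangles. *)
Lemma determining_prod (F1 : set (S1 -> R)) (F2 : set (S2 -> R)) :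
  weights F1 -> weights F2 -> determining F1 -> determining F2 ->
  determining [set h | exists f g, [/\ F1 f, F2 g &
                         h = fun z : S1 * S2 => f z.1 * g z.2]].
Proof.
move=> w1 w2 det1 det2 m1 m2 H.
(* The first factor is freed, the second still seen through [g]. *)
have fst_eq A g : measurable A -> F2 g ->
    (\int[m1]_(z in fst @^-1` A) (g z.2)%:E =
     \int[m2]_(z in fst @^-1` A) (g z.2)%:E)%E.
  move=> mA Fg; have [mg [M gM]] := w2 g Fg.
  have mg2 : measurable_fun [set: S1 * S2] (g \o snd) by exact: measurableT_comp.
  have gM2 (z : S1 * S2) : 0 <= (g \o snd) z <= M by exact: gM.
  have := det1 (weighted_image m1 measurable_fst mg2 gM2)
               (weighted_image m2 measurable_fst mg2 gM2).
  move=> /(_ _ A mA); apply => f Ff.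
  have [mf [N fN]] := w1 f Ff.
  have f0 y : (0 <= (f y)%:E)%E by rewrite lee_fin; case/andP: (fN y).
  rewrite !ge0_integral_weighted_imageE//; [|exact/measurable_EFinP..].
  by rewrite [LHS](H (fun z => f z.1 * g z.2)); last by exists f, g.
have rect_eq A B : measurable A -> measurable B -> m1 (A `*` B) = m2 (A `*` B).
  move=> mA mB.
  have mi : measurable_fun [set: S1 * S2] (\1_A \o fst : S1 * S2 -> R).
    by apply: measurableT_comp => //; exact: measurable_indic.
  have i01 (z : S1 * S2) : 0 <= ((\1_A \o fst) z : R) <= 1.
    by rewrite /= indicE ler0n lern1 leq_b1.
  have E (m : {finite_measure set (S1 * S2)%type -> \bar R}) :
      m (A `*` B) = weighted_image m measurable_snd mi i01 B.
    have mAT : measurable (fst @^-1` A : set (S1 * S2)).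
      by rewrite -[X in measurable X]setTI; exact: measurable_fst.
    have mBT : measurable (snd @^-1` B : set (S1 * S2)).
      by rewrite -[X in measurable X]setTI; exact: measurable_snd.
    rewrite /weighted_image -[LHS]/(m (fst @^-1` A `&` snd @^-1` B)).
    by rewrite -(integral_indic _ mBT mAT).
  rewrite !E; apply: det2 => // g Fg.
  have [mg [M gM]] := w2 g Fg.
  have g0 y : (0 <= (g y)%:E)%E by rewrite lee_fin; case/andP: (gM y).
  rewrite !ge0_integral_weighted_imageE//; [|exact/measurable_EFinP..].
  have E2 (m : {finite_measure set (S1 * S2)%type -> \bar R}) :
      (\int[m]_z ((g z.2)%:E * ((\1_A \o fst) z)%:E) =
       \int[m]_(z in fst @^-1` A) (g z.2)%:E)%E.
    rewrite [RHS]integral_mkcond; apply: eq_integral => z _.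
    rewrite patchE /= indicE.
    have -> : (z.1 \in A) = (z \in fst @^-1` A) by [].
    by case: ifPn => _; rewrite ?mule1 ?mule0.
  by rewrite !E2 fst_eq.
move=> B mB.
pose C := [set A `*` B | A in measurable & B in measurable] : set (set (S1 * S2)).
apply: (measure_unique C (fun=> setT)) => //.
- by rewrite measurable_prod_measurableType.
- move=> _ _ [X1 mX1 [X2 mX2 <-]] [Y1 mY1 [Y2 mY2 <-]].
  rewrite -setXI; exists (X1 `&` Y1); first exact: measurableI.
  by exists (X2 `&` Y2) => //; exact: measurableI.
- by move=> _; exists setT => //; exists setT => //; rewrite setXTT.
- by rewrite bigcup_const//; exists 0%N.
- by move=> _ [A mA [D mD <-]]; exact: rect_eq.
- by move=> _; rewrite -ge0_fin_numE// fin_num_measure.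
Qed.

End determining_prod.

Section plane_ripples.
Context {R : realType}.

(** Two-dimensional waves suffice: products of waves in [x] and in [y] are
    combinations of them by the addition formula. *)
Definition plane_ripples : set (R * R -> R) :=
  [set f | exists t s th, f = fun z => rcos (t * z.1 + s * z.2 + th)].

Lemma measurable_affine2 t s th :
  measurable_fun [set: R * R] (fun z : R * R => t * z.1 + s * z.2 + th).
Proof.
apply: measurable_funD => //.
by apply: measurable_funD; exact: measurable_funM.
Qed.

Lemma weights_ripples : weights (@ripples R).
Proof.
move=> _ [t [th ->]]; split; first exact: measurable_ripple.
by exists 2 => x; rewrite ripple_ge0 ripple_le2.
Qed.

Lemma weights_plane_ripples : weights plane_ripples.
Proof.
move=> _ [t [s [th ->]]]; split.
  exact: (measurableT_comp measurable_rcos (measurable_affine2 t s th)).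
by exists 2 => x; rewrite rcos_ge0 rcos_le2.
Qed.

Lemma plane_ripples_determining : determining plane_ripples.
Proof.
move=> m1 m2 H B mB.
have H' t s th : (\int[m1]_z (rcos (t * z.1 + s * z.2 + th))%:E =
                  \int[m2]_z (rcos (t * z.1 + s * z.2 + th))%:E)%E.
  by apply: H; exists t, s, th.
(* The product formula involves the total mass, so it is compared first. *)
have mT : m1 setT = m2 setT.
  have E (m : {finite_measure set (R * R)%type -> \bar R}) :
      m setT = (\int[m]_z (rcos (0 * z.1 + 0 * z.2 + pi / 2))%:E)%E.
    rewrite -[LHS]mul1e -(integral_cst m measurableT 1%E).
    by apply: eq_integral => z _; rewrite !mul0r !add0r /rcos cos_pihalf addr0.
  by rewrite !E H'.
apply: (determining_prod weights_ripples weights_ripples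
  (@ripples_determining R) (@ripples_determining R)) mB => _ [_ [_ [[t [a ->]] [s [b ->]] ->]]].
have m1' : measurable_fun [set: R * R] (fun z : R * R => t * z.1 + 0 * z.2 + a).
  exact: measurable_affine2.
have m2' : measurable_fun [set: R * R] (fun z : R * R => 0 * z.1 + s * z.2 + b).
  exact: measurable_affine2.
have E (m : {finite_measure set (R * R)%type -> \bar R}) :
    (\int[m]_z (ripple t a z.1 * ripple s b z.2)%:E + 2%:E * m setT =
     \int[m]_z (rcos (t * z.1 + 0 * z.2 + a))%:E +
     \int[m]_z (rcos (0 * z.1 + s * z.2 + b))%:E +
     (2^-1)%:E * \int[m]_z (rcos (t * z.1 + s * z.2 + (a + b)))%:E +
     (2^-1)%:E * \int[m]_z (rcos (t * z.1 + (- s) * z.2 + (a - b)))%:E)%E.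
  transitivity (\int[m]_z (rcos (t * z.1 + 0 * z.2 + a) * rcos (0 * z.1 + s * z.2 + b))%:E
     + 2%:E * m setT)%E.
    congr (_ + _)%E; apply: eq_integral => z _; rewrite /ripple.
    by rewrite !mul0r add0r addr0.
  rewrite integral_rcosM//; congr (_ + _ * _ + _ * _)%E;
    by apply: eq_integral => z _; congr (rcos _)%:E; ring.
apply: (@adde_cancelr _ _ _ (2%:E * m1 setT)%E).
  by rewrite fin_numM// fin_num_measure.
by rewrite E mT E !H'.
Qed.

End plane_ripples.

(** * Independence from the characteristic function *)

Section independence.
Context d (T : measurableType d) d' (S : measurableType d') (R : realType)
  (P : probability T R).

(** The joint law and the product of the laws have the same integrals
    against products of test functions. *)
Lemma determining_independent (F : set (R -> R)) (G : set (S -> R))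
    (X : T -> R) (Y : T -> S) :
  weights F -> weights G -> determining F -> determining G ->
  measurable_fun [set: T] X -> measurable_fun [set: T] Y ->
  (forall f g, F f -> G g ->
     \int[P]_w (f (X w) * g (Y w))%:E =
     \int[P]_w (f (X w))%:E * \int[P]_w (g (Y w))%:E)%E ->
  forall A B, measurable A -> measurable B ->
  P (X @^-1` A `&` Y @^-1` B) = (P (X @^-1` A) * P (Y @^-1` B))%E.
Proof.
move=> wF wG dF dG mX mY H A B mA mB.
pose XY w := (X w, Y w).
have mXY : measurable_fun [set: T] XY by exact: measurable_fun_pair.
pose X' : {mfun T >-> R} := HB.pack X (@isMeasurableFun.Build _ _ _ _ X mX).
pose Y' : {mfun T >-> S} := HB.pack Y (@isMeasurableFun.Build _ _ _ _ Y mY).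
pose Z : {mfun T >-> (R * S)%type} :=
  HB.pack XY (@isMeasurableFun.Build _ _ _ _ XY mXY).
have -> : X @^-1` A `&` Y @^-1` B = Z @^-1` (A `*` B) by [].
transitivity ((distribution P X' \x distribution P Y')%E (A `*` B)); last first.
  by rewrite product_measure1E.
have det := determining_prod wF wG dF dG.
pose nu : probability (R * S)%type R := (distribution P X' \x distribution P Y')%E.
have := det (distribution P Z) nu.
move=> /(_ _ _ (measurableX mA mB)); apply.
move=> _ [f [g [Ff Gg ->]]].
have [mf [M fM]] := wF f Ff; have [mg [N gN]] := wG g Gg.
have f0 x : 0 <= f x by case/andP: (fM x).
have g0 x : 0 <= g x by case/andP: (gN x).
have mfg : measurable_fun [set: R * S] (fun z : R * S => (f z.1 * g z.2)%:E).
  apply/measurable_EFinP/measurable_funM.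
    exact: (measurableT_comp mf).
  exact: (measurableT_comp mg).
rewrite ge0_integral_distribution//; last by move=> z; rewrite lee_fin mulr_ge0.
rewrite [LHS]H// fubini_tonelli1//; last by move=> z; rewrite lee_fin mulr_ge0.
rewrite /fubini_F/=.
under [RHS]eq_integral => x _.
  under eq_integral do rewrite EFinM.
  rewrite ge0_integralZl ?lee_fin//; last 2 first.
    exact/measurable_EFinP.
    by move=> y _; rewrite lee_fin.
  over.
rewrite ge0_integralZr//.
- rewrite !ge0_integral_distribution//.
  + exact/measurable_EFinP.
  + exact/measurable_EFinP.
- exact/measurable_EFinP.
- by move=> x _; rewrite lee_fin.
- by apply: integral_ge0 => x _; rewrite lee_fin.
Qed.

End independence.

Section gaussian_independence.
Context d (T : measurableType d) (R : realType) (P : probability T R).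
Variables (X1 X2 X3 : {mfun T >-> R}) (v1 v2 v3 : R) (psi : R -> R).
Hypotheses (v1_ge0 : 0 <= v1) (v2_ge0 : 0 <= v2) (v3_ge0 : 0 <= v3).
Hypothesis psiD : forall v w, 0 <= v -> 0 <= w -> psi (v + w) = psi v * psi w.
Hypothesis charX : forall a1 a2 a3 th,
  (\int[P]_w (rcos (a1 * X1 w + a2 * X2 w + a3 * X3 w + th))%:E =
   (1 + cos th * psi (a1 ^+ 2 * v1 + a2 ^+ 2 * v2 + a3 ^+ 2 * v3))%:E)%E.

Let mX (X : {mfun T >-> R}) : measurable_fun [set: T] X.
Proof. exact: measurable_funP. Qed.

Let lin a1 a2 a3 th w := a1 * X1 w + a2 * X2 w + a3 * X3 w + th.

Let mlin a1 a2 a3 th : measurable_fun [set: T] (lin a1 a2 a3 th).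
Proof.
apply: measurable_funD => //; apply: measurable_funD; last exact: measurable_funM.
by apply: measurable_funD; exact: measurable_funM.
Qed.

Let char_mul (a1 a2 a3 a b1 b2 b3 b : R) : a1 * b1 = 0 -> a2 * b2 = 0 -> a3 * b3 = 0 ->
  (\int[P]_w (rcos (lin a1 a2 a3 a w) * rcos (lin b1 b2 b3 b w))%:E =
   \int[P]_w (rcos (lin a1 a2 a3 a w))%:E * \int[P]_w (rcos (lin b1 b2 b3 b w))%:E)%E.
Proof.
move=> ab1 ab2 ab3.
apply: (@adde_cancelr _ _ _ (2%:E * P setT)%E).
  by rewrite probability_setT.
rewrite integral_rcosM//.
have -> : (\int[P]_w (rcos (lin a1 a2 a3 a w + lin b1 b2 b3 b w))%:E =
    \int[P]_w (rcos ((a1 + b1) * X1 w + (a2 + b2) * X2 w + (a3 + b3) * X3 w + (a + b)))%:E)%E.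
  by apply: eq_integral => w _; congr (rcos _)%:E; rewrite /lin; ring.
have -> : (\int[P]_w (rcos (lin a1 a2 a3 a w - lin b1 b2 b3 b w))%:E =
    \int[P]_w (rcos ((a1 - b1) * X1 w + (a2 - b2) * X2 w + (a3 - b3) * X3 w + (a - b)))%:E)%E.
  by apply: eq_integral => w _; congr (rcos _)%:E; rewrite /lin; ring.
rewrite !charX probability_setT -!EFinM -!EFinD; congr EFin.
set q1 := a1 ^+ 2 * v1 + a2 ^+ 2 * v2 + a3 ^+ 2 * v3.
set q2 := b1 ^+ 2 * v1 + b2 ^+ 2 * v2 + b3 ^+ 2 * v3.
have q10 : 0 <= q1 by rewrite !addr_ge0// mulr_ge0// sqr_ge0.
have q20 : 0 <= q2 by rewrite !addr_ge0// mulr_ge0// sqr_ge0.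
have -> : (a1 + b1) ^+ 2 * v1 + (a2 + b2) ^+ 2 * v2 + (a3 + b3) ^+ 2 * v3 = q1 + q2.
  rewrite !sqrrD ab1 ab2 ab3 !mul0rn !addr0 /q1 /q2; ring.
have -> : (a1 - b1) ^+ 2 * v1 + (a2 - b2) ^+ 2 * v2 + (a3 - b3) ^+ 2 * v3 = q1 + q2.
  rewrite !sqrrB ab1 ab2 ab3 !mul0rn !subr0 /q1 /q2; ring.
by rewrite (psiD q10 q20) cosD cosB; move: (psi q1) (psi q2) => p1 p2; lra.
Qed.

(** Cross terms vanish in the quadratic form [v1 a1^2 + v2 a2^2 + v3 a3^2]
    when two frequency vectors have disjoint supports, and [psi] turns sums of
    variances into products; so waves in [X1] are uncorrelated with waves in
    the pair, and waves in [X2] with waves in [X3]. *)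
Lemma gaussian_independent A B : measurable A -> measurable B ->
  P (X1 @^-1` A `&` (fun w => (X2 w, X3 w)) @^-1` B) =
  (P (X1 @^-1` A) * (distribution P X2 \x distribution P X3) B)%E.
Proof.
move=> mA mB.
rewrite (determining_independent weights_ripples weights_plane_ripples
  (@ripples_determining R) (@plane_ripples_determining R))//; first last.
- move=> _ _ [t [a ->]] [s2 [s3 [b ->]]].
  have E1 w : ripple t a (X1 w) = rcos (lin t 0 0 a w).
    by rewrite /ripple /lin !mul0r !addr0.
  have E2 w : rcos (s2 * X2 w + s3 * X3 w + b) = rcos (lin 0 s2 s3 b w).
    by rewrite /lin mul0r add0r.
  under eq_integral do rewrite E1 E2.
  rewrite char_mul ?mulr0 ?mul0r//.
  by congr (_ * _)%E; apply: eq_integral => w _; rewrite ?E1 ?E2.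
- by apply: measurable_fun_pair.
congr (_ * _)%E; apply/esym.
pose Y w := (X2 w, X3 w).
have mY : measurable_fun [set: T] Y by exact: measurable_fun_pair.
pose Z : {mfun T >-> (R * R)%type} :=
  HB.pack Y (@isMeasurableFun.Build _ _ _ _ Y mY).
rewrite [LHS](@product_measure_unique _ _ _ _ _ (distribution P X2) (distribution P X3) (distribution P Z))//.
move=> C D mC mD.
rewrite -[LHS]/(P (X2 @^-1` C `&` X3 @^-1` D)).
apply: (determining_independent weights_ripples weights_ripples
  (@ripples_determining R) (@ripples_determining R)) => // _ _ [s [a ->]] [t [b ->]].
have E1 w : ripple s a (X2 w) = rcos (lin 0 s 0 a w).
  by rewrite /ripple /lin !mul0r add0r addr0.
have E2 w : ripple t b (X3 w) = rcos (lin 0 0 t b w).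
  by rewrite /ripple /lin !mul0r !add0r.
under eq_integral do rewrite E1 E2.
rewrite char_mul ?mulr0 ?mul0r//.
by congr (_ * _)%E; apply: eq_integral => w _; rewrite ?E1 ?E2.
Qed.

End gaussian_independence.

(** * The normal law and its characteristic function *)

Section normal.
Context {R : realType}.
Local Notation mu := (@lebesgue_measure R).
Implicit Types (x y a b c s t th v w : R).

Lemma ge0_integral_normal m s (f : R -> \bar R) :
  measurable_fun [set: R] f -> (forall x, 0 <= f x)%E ->
  (\int[normal_prob m s]_x f x = \int[mu]_x (f x * (normal_pdf m s x)%:E))%E.
Proof.
move=> mf f0.
apply: (@ge0_integral_weighted_image _ _ (measurableTypeR R) _ R mu
  (normal_prob m s) idfun (normal_pdf m s)) => //.
- exact: measurable_id.
- exact: measurable_normal_pdf.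
- exact: normal_pdf_ge0.
Qed.

Lemma normal_pdf_expR m s x : 0 < s ->
  normal_pdf m s x =
  (s * Num.sqrt (pi * 2))^-1 * expR (- ((x - m) ^+ 2 / (2 * s ^+ 2))).
Proof.
move=> s0; rewrite normal_pdfE ?gt_eqF// /normal_peak /normal_fun.
congr (_^-1 * expR _); last by rewrite mulNr [2 * _]mulrC mulr_natr.
by rewrite -mulr_natr -mulrA sqrtrM ?sqr_ge0// sqrtr_sqr gtr0_norm.
Qed.

(** Completing the square: as a function of [y] the product is a normal
    density, up to the factor that is the density of the sum at [x]. *)
Lemma normal_pdfM a b x y : 0 < a -> 0 < b ->
  let c := Num.sqrt (a ^+ 2 + b ^+ 2) in
  normal_pdf 0 a (x - y) * normal_pdf 0 b y =
  normal_pdf 0 c x * normal_pdf (x * b ^+ 2 / c ^+ 2) (a * b / c) y.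
Proof.
move=> a0 b0 c.
have c20 : 0 < a ^+ 2 + b ^+ 2 by rewrite addr_gt0// exprn_gt0.
have c0 : 0 < c by rewrite sqrtr_gt0.
have cE : c ^+ 2 = a ^+ 2 + b ^+ 2 by rewrite sqr_sqrtr// ltW.
have p0 : 0 < Num.sqrt (pi * 2 : R) by rewrite sqrtr_gt0 mulr_gt0// pi_gt0.
rewrite !normal_pdf_expR//; last by rewrite divr_gt0// mulr_gt0.
rewrite mulrACA -expRD [RHS]mulrACA -expRD !subr0; congr (_ * expR _).
  by field; rewrite ?gt_eqF.
rewrite !expr_div_n exprMn cE.
by field; rewrite ?gt_eqF.
Qed.

(** The normal laws are stable under convolution. *)
Lemma ge0_integral_normalD a b (f : R -> R) : 0 < a -> 0 < b ->
  measurable_fun [set: R] f -> (forall x, 0 <= f x) ->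
  (\int[normal_prob 0 b]_y \int[normal_prob 0 a]_x (f (x + y))%:E =
   \int[normal_prob 0 (Num.sqrt (a ^+ 2 + b ^+ 2))]_x (f x)%:E)%E.
Proof.
move=> a0 b0 mf f0; set c := Num.sqrt _.
have mEf : measurable_fun [set: R] (EFin \o f) by exact/measurable_EFinP.
have pdf0 m s x : (0 <= (normal_pdf m s x)%:E)%E by rewrite lee_fin normal_pdf_ge0.
have f0' x : (0 <= (f x)%:E)%E by rewrite lee_fin.
have mpdf m s : measurable_fun [set: R] (fun x => (normal_pdf m s x)%:E).
  by apply/measurable_EFinP; exact: measurable_normal_pdf.
(* The joint density of the sum and of the second summand, weighted by [f]. *)
pose h (z : measurableTypeR R * measurableTypeR R) :=
  ((f z.1)%:E * (normal_pdf 0 a (z.1 - z.2))%:E * (normal_pdf 0 b z.2)%:E)%E.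
have h0 z : (0 <= h z)%E by rewrite !mule_ge0.
have mh : measurable_fun [set: measurableTypeR R * measurableTypeR R] h.
  apply: emeasurable_funM; first apply: emeasurable_funM.
  - by apply/measurable_EFinP; exact: (measurableT_comp mf measurable_fst).
  - apply/measurable_EFinP; apply: (measurableT_comp (measurable_normal_pdf 0 a)).
    by apply: measurable_funB; [exact: measurable_fst|exact: measurable_snd].
  - apply/measurable_EFinP.
    by apply: (measurableT_comp (measurable_normal_pdf 0 b)); exact: measurable_snd.
transitivity (\int[mu]_y \int[mu]_x h (x, y))%E.
  rewrite ge0_integral_normal//.
  - apply: eq_integral => y _.
    pose g x : \bar R := ((f x)%:E * (normal_pdf 0 a (x - y))%:E)%E.
    have g0 x : (0 <= g x)%E by exact: mule_ge0.
    have mg : measurable_fun [set: R] g.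
      apply: emeasurable_funM => //.
      apply/measurable_EFinP; apply: (measurableT_comp (measurable_normal_pdf 0 a)).
      exact: measurable_funB.
    have -> : (\int[normal_prob 0 a]_x (f (x + y))%:E = \int[mu]_x g x)%E.
      rewrite ge0_integral_normal.
      + rewrite -(ge0_integral_translate y mg g0).
        by apply: eq_integral => x _; rewrite /g addrK.
      + by apply/measurable_EFinP; apply: (measurableT_comp mf); exact: measurable_funD.
      + by move=> x; rewrite lee_fin.
    rewrite -ge0_integralZr; [by []|exact: measurableT|exact: mg| |exact: pdf0].
    by move=> x _; exact: g0.
  - pose g (z : R * R) := (f (z.2 + z.1))%:E.
    have := @measurable_fun_fubini_tonelli_F _ _ R (measurableTypeR R) R
      (normal_prob 0 a) g.
    apply.
    + apply/measurable_EFinP; apply: (measurableT_comp mf).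
      exact: measurable_funD.
    + by move=> z; rewrite lee_fin.
  - by move=> y; apply: integral_ge0 => x _.
rewrite -(sfinite_Fubini mu mu h)// ge0_integral_normal//.
apply: eq_integral => x _.
have hE y : h (x, y) = ((f x)%:E * (normal_pdf 0 c x)%:E *
    (normal_pdf (x * b ^+ 2 / c ^+ 2) (a * b / c) y)%:E)%E.
  rewrite /h /= -!EFinM -[LHS]/((_ * _ * _)%:E) -[in LHS]mulrA -[RHS]/((_ * _ * _)%:E).
  by rewrite (normal_pdfM _ _ a0 b0) mulrA.
under eq_integral do rewrite hE.
rewrite ge0_integralZl//.
- by rewrite integral_normal_pdf mule1.
- exact: mpdf.
- by rewrite mule_ge0.
Qed.

End normal.

Section normal_char.
Context {R : realType}.
Local Notation mu := (@lebesgue_measure R).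
Implicit Types (x y a b c s t th v w : R).

Lemma bounded_integrable d (T : measurableType d)
    (m : {finite_measure set T -> \bar R}) (f : T -> R) (M : R) :
  measurable_fun [set: T] f -> (forall x : T, `|f x| <= M) ->
  m.-integrable [set: T] (EFin \o f).
Proof.
move=> mf fM; apply: measurable_bounded_integrable => //.
  by rewrite -ge0_fin_numE// fin_num_measure.
exists M; split; first exact: num_real.
by move=> N MN x _; rewrite /= (le_trans (fM x))// ltW.
Qed.

Lemma measurable_sin : measurable_fun [set: R] (@sin R).
Proof. by apply: continuous_measurable_fun; exact: continuous_sin. Qed.

Lemma measurable_cos : measurable_fun [set: R] (@cos R).
Proof. by apply: continuous_measurable_fun; exact: continuous_cos. Qed.

Lemma normal_probN s (A : set R) : 0 < s -> measurable A ->
  normal_prob 0 s (-%R @^-1` A) = normal_prob 0 s A.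
Proof.
move=> s0 mA.
have mmA : measurable (-%R @^-1` A : set R).
  by rewrite -[X in measurable X]setTI; exact: oppr_measurable.
rewrite /normal_prob integral_mkcond [RHS]integral_mkcond.
pose f := (fun x => (normal_pdf 0 s x)%:E) \_ A.
have mf : measurable_fun [set: R] f.
  apply/(measurable_restrictT _ _).1 => //; apply: measurable_funTS.
  by apply/measurable_EFinP; exact: measurable_normal_pdf.
have := @ge0_integral_preserving _ (measurableTypeR R) R mu -%R _ _ f mf _.
move=> <-.
- apply: eq_integral => x _; rewrite /f !patchE.
  have -> : (- x \in A) = (x \in -%R @^-1` A) by [].
  by case: ifPn => // _; rewrite !normal_pdf_expR// !subr0 sqrrN.
- exact: oppr_measurable.
- by move=> B mB; exact: lebesgue_measureN.
- by move=> x; rewrite erestrict_ge0// => y; rewrite lee_fin normal_pdf_ge0.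
Qed.

Lemma Rintegral_normal_odd s (f : R -> R) : 0 < s ->
  measurable_fun [set: R] f -> (forall x, f (- x) = - f x) ->
  \int[normal_prob 0 s]_x f x = 0.
Proof.
move=> s0 mf oddf; rewrite /Rintegral.
have mEf : measurable_fun [set: R] (EFin \o f) by exact/measurable_EFinP.
rewrite -[X in fine X]/(\int[normal_prob 0 s]_x (EFin \o f) x)%E integralE.
have -> : (\int[normal_prob 0 s]_x (EFin \o f)^\- x =
           \int[normal_prob 0 s]_x (EFin \o f)^\+ x)%E.
  rewrite -(@ge0_integral_preserving _ _ R (normal_prob 0 s) -%R _ _ ((EFin \o f)^\+)%E)//.
  - apply: eq_integral => x _.
    by rewrite !funeposE funenegE/= oddf.
  - by move=> A mA; exact: normal_probN.
  - exact: measurable_funepos.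
set I := (\int[_]_x _)%E.
have I0 : (0 <= I)%E by apply: integral_ge0.
by move: I I0 => [r _| _|]//=; rewrite ?subrr.
Qed.

(** The characteristic function of the centered normal law, at frequency 1.
    It is real by symmetry, and multiplicative in the variance. *)
Definition normal_char s := \int[normal_prob 0 s]_x cos x.

Lemma integral_normal_affine_cos s (p q : R) : 0 < s ->
  (\int[normal_prob 0 s]_x (p + q * cos x)%:E = (p + q * normal_char s)%:E)%E.
Proof.
move=> s0.
have ic : (normal_prob 0 s).-integrable [set: R] (EFin \o (@cos R)).
  by apply: (@bounded_integrable _ _ _ _ 1); [exact: measurable_cos|exact: cos_max].
have iqc : (normal_prob 0 s).-integrable [set: R] (EFin \o (fun x => q * cos x)).
  apply: (@bounded_integrable _ _ _ _ `|q|).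
    by apply: measurable_funM => //; exact: measurable_cos.
  by move=> x; rewrite normrM ler_piMr// cos_max.
have ip : (normal_prob 0 s).-integrable [set: R] (EFin \o cst p).
  exact: (@bounded_integrable _ _ _ _ `|p|).
rewrite -[LHS]fineK; last first.
  apply: integrable_fin_num => //.
  exact: (integrableD measurableT ip iqc).
congr EFin; rewrite -[LHS]/(\int[normal_prob 0 s]_x (cst p x + q * cos x)).
rewrite RintegralD// RintegralZl// Rintegral_cst//; congr (_ + _).
rewrite -[RHS]mulr1; congr (_ * _).
by rewrite -[RHS]/(fine 1%E); congr fine; exact: (@probability_setT _ _ _ (normal_prob 0 s)).
Qed.

Lemma integral_normal_rcos s th : 0 < s ->
  (\int[normal_prob 0 s]_x (rcos (x + th))%:E = (1 + cos th * normal_char s)%:E)%E.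
Proof.
move=> s0; rewrite -integral_normal_affine_cos//.
have i1 : (normal_prob 0 s).-integrable [set: R] (EFin \o (fun x => 1 + cos th * cos x)).
  apply: (@bounded_integrable _ _ _ _ 2).
    by apply: measurable_funD => //; apply: measurable_funM => //; exact: measurable_cos.
  move=> x; rewrite (le_trans (ler_normD _ _))// normr1 lerD2l normrM.
  by rewrite mulr_ile1// cos_max.
have i2 : (normal_prob 0 s).-integrable [set: R] (EFin \o (fun x => sin th * sin x)).
  apply: (@bounded_integrable _ _ _ _ 1).
    by apply: measurable_funM => //; exact: measurable_sin.
  by move=> x; rewrite normrM mulr_ile1// sin_max.
have i3 : (normal_prob 0 s).-integrable [set: R] (EFin \o (@sin R)).
  by apply: (@bounded_integrable _ _ _ _ 1); [exact: measurable_sin|exact: sin_max].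
have E x : rcos (x + th) = (1 + cos th * cos x) - sin th * sin x.
  by rewrite /rcos cosD; ring.
under eq_integral do rewrite E EFinB.
rewrite integralB_EFin// -[X in (_ - X)%E]fineK ?integrable_fin_num//.
rewrite -[fine _]/(\int[normal_prob 0 s]_x (sin th * sin x)) RintegralZl//.
rewrite Rintegral_normal_odd//; [by rewrite mulr0 sube0|exact: measurable_sin|].
exact: sinN.
Qed.

(** Read off from stability under convolution, integrating the raised
    cosine. *)
Lemma normal_charD a b : 0 < a -> 0 < b -> normal_char (Num.sqrt (a ^+ 2 + b ^+ 2)) = normal_char a * normal_char b.
Proof.
move=> a0 b0.
have := ge0_integral_normalD a0 b0 measurable_rcos (@rcos_ge0 R).
under eq_integral do rewrite integral_normal_rcos// [cos _ * _]mulrC.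
rewrite integral_normal_affine_cos//.
have c0 : 0 < Num.sqrt (a ^+ 2 + b ^+ 2) by rewrite sqrtr_gt0 addr_gt0// exprn_gt0.
have := integral_normal_rcos 0 c0.
under eq_integral do rewrite addr0.
rewrite cos0 mul1r => H2; rewrite H2 => H1.
by have := congr1 fine H1 => /= /addrI.
Qed.

(** The value at variance 0 is that of the point mass, so that
    multiplicativity includes degenerate laws. *)
Definition gaussian_char v := if v == 0 then 1 else normal_char (Num.sqrt v).

Lemma gaussian_charD v w : 0 <= v -> 0 <= w -> gaussian_char (v + w) = gaussian_char v * gaussian_char w.
Proof.
move=> v0 w0; rewrite /gaussian_char.
have [->|vn0] := eqVneq v 0; first by rewrite add0r mul1r.
have [->|wn0] := eqVneq w 0; first by rewrite addr0 mulr1 (negbTE vn0).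
have vp : 0 < v by rewrite lt_neqAle eq_sym vn0.
have wp : 0 < w by rewrite lt_neqAle eq_sym wn0.
have sv : 0 < Num.sqrt v by rewrite sqrtr_gt0.
have sw : 0 < Num.sqrt w by rewrite sqrtr_gt0.
have -> : (v + w == 0) = false by rewrite gt_eqF// addr_gt0.
by rewrite -(normal_charD sv sw) (sqr_sqrtr v0) (sqr_sqrtr w0).
Qed.

Context d (T : measurableType d) (P : probability T R).

Lemma ge0_integral_gaussian (X : {mfun T >-> R}) v (f : R -> \bar R) :
  is_gaussian P X 0 v -> measurable_fun [set: R] f -> (forall x, 0 <= f x)%E ->
  (\int[P]_w f (X w))%E =
  if v == 0 then f 0 else (\int[normal_prob 0 (Num.sqrt v)]_x f x)%E.
Proof.
move=> [v0 gX] mf f0.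
transitivity (\int[distribution P X]_x f x)%E.
  by rewrite ge0_integral_distribution.
case: ifPn => v0'.
  transitivity (\int[\d_(0%R : R)]_x f x)%E.
    apply: eq_measure_integral => A mA _.
    by rewrite [LHS]gX// /gaussian_law v0'.
  by rewrite integral_dirac// diracT mul1e.
rewrite ge0_integral_normal//.
apply: (@ge0_integral_weighted_image _ _ (measurableTypeR R) _ R mu
  (distribution P X) idfun (normal_pdf 0 (Num.sqrt v))) => //.
- exact: measurable_id.
- exact: measurable_normal_pdf.
- exact: normal_pdf_ge0.
- by move=> A mA; rewrite [LHS]gX// /gaussian_law (negbTE v0').
Qed.

Lemma integral_gaussian_rcos (X : {mfun T >-> R}) v th : is_gaussian P X 0 v ->
  (\int[P]_w (rcos (X w + th))%:E = (1 + cos th * gaussian_char v)%:E)%E.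
Proof.
move=> gX.
rewrite (ge0_integral_gaussian (f := fun x => (rcos (x + th))%:E) gX).
- rewrite /gaussian_char; case: ifPn => v0; first by rewrite add0r /rcos mulr1.
  by rewrite integral_normal_rcos// sqrtr_gt0 lt_neqAle eq_sym v0; case: gX.
- apply/measurable_EFinP; apply: (measurableT_comp measurable_rcos).
  exact: measurable_funD.
- by move=> x; rewrite lee_fin rcos_ge0.
Qed.

End normal_char.

(** * Areas of discs and the tail of the planar normal law *)

Section areas.
Context {R : realType}.
Local Notation MR := (measurableTypeR R).
Local Notation mu := (@lebesgue_measure R).
Implicit Types (x y a b c s t u : R).

Definition sqn (z : R * R) : R := z.1 ^+ 2 + z.2 ^+ 2.

Lemma sqn_ge0 z : 0 <= sqn z.
Proof. by rewrite addr_ge0// sqr_ge0. Qed.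

Lemma measurable_sqn : measurable_fun [set: MR * MR] sqn.
Proof.
apply: measurable_funD; apply: measurable_funX.
  exact: measurable_fst.
exact: measurable_snd.
Qed.

Lemma measurable_sqn_le t : measurable [set z : MR * MR | sqn z <= t].
Proof.
rewrite -[X in measurable X]setTI.
rewrite (_ : [set z | _] = sqn @^-1` `]-oo, t]); last first.
  by apply/seteqP; split => z /=; rewrite in_itv.
exact: measurable_sqn.
Qed.

Lemma measurable_sqn_gt t : measurable [set z : MR * MR | t < sqn z].
Proof.
rewrite -[X in measurable X]setTI.
rewrite (_ : [set z | _] = sqn @^-1` `]t, +oo[); last first.
  by apply/seteqP; split => z /=; rewrite in_itv/= andbT.
exact: measurable_sqn.
Qed.

(** A dilation by [sqrt t] in both coordinates multiplies areas by [t].  The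
    area of the unit disc is left as an unknown constant. *)
Lemma leb2_sqn_le t : 0 < t ->
  leb2 [set z : R * R | sqn z <= t] = (t%:E * leb2 [set z : R * R | (sqn z <= 1)%R])%E.
Proof.
move=> t0; have st0 : 0 < Num.sqrt t by rewrite sqrtr_gt0.
have ms : measurable_fun [set: R] (fun x => Num.sqrt t * x + 0).
  by apply: measurable_funD => //; exact: measurable_funM.
rewrite -(@leb2_map _ _ _ _ t (ltW t0) ms ms); last 2 first.
- move=> B C mB mC.
  rewrite -(@lebesgue_measure_affine _ (Num.sqrt t) 0 B)//.
  rewrite -[in RHS](@lebesgue_measure_affine _ (Num.sqrt t) 0 C)//.
  by rewrite muleACA -EFinM -expr2 sqr_sqrtr ?ltW.
- exact: measurable_sqn_le.
congr (_ * leb2 _)%E; apply/seteqP; split => z /=;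
  by rewrite /sqn /= !addr0 !exprMn sqr_sqrtr ?(ltW t0)// -mulrDr ger_pMr.
Qed.

Lemma leb2_sqn_le1_fin : leb2 [set z : R * R | (sqn z <= 1)%R] \is a fin_num.
Proof.
have m1 : measurable [set z : MR * MR | sqn z <= 1] by exact: measurable_sqn_le.
rewrite ge0_fin_numE ?measure_ge0//.
pose I : set MR := [set` `[(-1 : R), 1]].
have mI : measurable I by exact: measurable_itv.
apply: (@le_lt_trans _ _ (leb2 (I `*` I))).
  apply: le_measure; rewrite ?inE//; first exact: measurableX.
  move=> z /= z1; split => /=; rewrite /I /= in_itv/= -ler_norml -[leRHS]normr1;
    rewrite -ler_sqr ?nnegrE// !real_normK ?num_real// expr1n.
    by apply: le_trans z1; rewrite lerDl sqr_ge0.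
  by apply: le_trans z1; rewrite lerDr sqr_ge0.
have muI : mu I = (2 : R)%:E.
  rewrite /I lebesgue_measure_itv/= lte_fin ifT; last by lra.
  by rewrite -EFinD; congr EFin; ring.
have -> : leb2 (I `*` I) = (mu I * mu I)%E by rewrite /leb2 product_measure1E.
by rewrite muI -EFinM ltry.
Qed.

Lemma leb2_sqn_le0 : leb2 [set z : R * R | sqn z <= 0] = 0.
Proof.
have -> : [set z : R * R | sqn z <= 0] = [set 0] `*` [set 0].
  apply/seteqP; split => -[x y] /=; rewrite /sqn/=.
    by rewrite real_leNgt ?num_real// lt_neqAle addr_ge0 ?sqr_ge0// andbT negbK
      eq_sym paddr_eq0 ?sqr_ge0// !sqrf_eq0 => /andP[/eqP -> /eqP ->].
  by move=> [-> ->]; rewrite expr0n addr0.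
pose O : set MR := [set (0 : R)].
have mO : measurable O by exact: measurable_set1.
have muO : mu O = 0%E by exact: lebesgue_measure_set1.
by rewrite -[LHS]/(leb2 (O `*` O)) /leb2 product_measure1E// [X in (X * _)%E]muO mul0e.
Qed.

Lemma leb2_annulus t u : 0 <= t ->
  leb2 [set z : R * R | t < sqn z <= u] =
  ((Num.max (u - t) 0)%:E * leb2 [set z : R * R | (sqn z <= 1)%R])%E.
Proof.
move=> t0; set A := leb2 [set z | _ <= 1].
have [ut|tu] := leP u t.
  have -> : [set z : R * R | t < sqn z <= u] = set0.
    by apply/seteqP; split => z //= /andP[tz zu]; have := lt_le_trans tz zu; rewrite ltNge ut.
  by rewrite /leb2 measure0 max_r ?mul0e// subr_le0.
have u0 : 0 < u by exact: le_lt_trans tu.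
have V w : 0 <= w -> leb2 [set z : R * R | sqn z <= w] = (w%:E * A)%E.
  rewrite le_eqVlt => /predU1P[<-|]; first by rewrite leb2_sqn_le0 mul0e.
  exact: leb2_sqn_le.
have -> : [set z : R * R | t < sqn z <= u] =
    [set z | sqn z <= u] `\` [set z | sqn z <= t].
  apply/seteqP; split => z /=; first by move=> /andP[tz ->]; split => //; apply/negP; rewrite -ltNge.
  by move=> [->]; move/negP; rewrite -ltNge => ->.
have Afin : A \is a fin_num by exact: leb2_sqn_le1_fin.
have mle w : measurable [set z : MR * MR | sqn z <= w] by exact: measurable_sqn_le.
have Vt := V t t0; have Vu := V u (ltW u0).
rewrite [LHS](@measureD _ _ _ (mu \x mu)%E _ _ (mle u) (mle t)); last first.
  rewrite [X in (X < _)%E]Vu ltey_eq fin_numM//.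
rewrite setIidr; last by move=> z /= zt; apply: le_trans zt _; exact: ltW.
rewrite [X in (X - _)%E]Vu [X in (_ - X)%E]Vt -muleBl//.
by rewrite -EFinB max_l// subr_ge0 ltW.
Qed.

End areas.

Section planar_normal.
Context {R : realType}.
Local Notation MR := (measurableTypeR R).
Local Notation mu := (@lebesgue_measure R).
Implicit Types (x y a b c s t u : R).

Definition normal2 s := (normal_prob 0 s \x normal_prob 0 s)%E.

Lemma normal_pdf2 s x y : 0 < s ->
  normal_pdf 0 s x * normal_pdf 0 s y =
  (s * Num.sqrt (pi * 2)) ^- 2 * expR (- ((2 * s ^+ 2)^-1 * sqn (x, y))).
Proof.
move=> s0; rewrite !normal_pdf_expR// mulrACA -expRD !subr0; congr (_ * expR _).
  by rewrite -exprVn expr2.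
by rewrite /sqn/=; field; rewrite gt_eqF.
Qed.

Lemma ge0_integral_normal2 s (f : R * R -> \bar R) :
  measurable_fun [set: MR * MR] f -> (forall z, 0 <= f z)%E ->
  (\int[normal2 s]_z f z =
   \int[mu \x mu]_z (f z * (normal_pdf 0 s z.1 * normal_pdf 0 s z.2)%:E))%E.
Proof.
move=> mf f0.
have p0 x : (0 <= (normal_pdf 0 s x)%:E)%E by rewrite lee_fin normal_pdf_ge0.
have mp : measurable_fun [set: MR] (fun x => (normal_pdf 0 s x)%:E).
  by apply/measurable_EFinP; exact: measurable_normal_pdf.
have mp12 : measurable_fun [set: MR * MR]
    (fun z : R * R => (normal_pdf 0 s z.1 * normal_pdf 0 s z.2)%:E).
  apply/measurable_EFinP/measurable_funM.
    exact: (measurableT_comp (measurable_normal_pdf 0 s) measurable_fst).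
  exact: (measurableT_comp (measurable_normal_pdf 0 s) measurable_snd).
have pp0 (z : R * R) : (0 <= (normal_pdf 0 s z.1 * normal_pdf 0 s z.2)%:E)%E.
  by rewrite EFinM mule_ge0.
have mfx x : measurable_fun [set: MR] (fun y => f (x, y)).
  exact: (measurable_fun_pair2 x mf).
rewrite [LHS](fubini_tonelli1 (m1 := normal_prob 0 s) (m2 := normal_prob 0 s) f)//.
rewrite [RHS](fubini_tonelli1 (m1 := mu) (m2 := mu)); last 2 first.
- exact: emeasurable_funM.
- by move=> z; rewrite mule_ge0.
rewrite ge0_integral_normal; last 2 first.
- exact: (measurable_fun_fubini_tonelli_F (m2 := normal_prob 0 s) f mf f0).
- by move=> x; apply: integral_ge0 => y _.
apply: eq_integral => x _; rewrite /fubini_F/=.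
rewrite ge0_integral_normal//; last exact: mfx.
rewrite -ge0_integralZr//.
- by apply: eq_integral => y _; rewrite -muleA -EFinM [normal_pdf 0 s y * _]mulrC.
- by apply: emeasurable_funM; [exact: mfx|exact: mp].
- by move=> y _; rewrite mule_ge0.
Qed.

Lemma integral_expR_tail (l q : R) : 0 < l ->
  (\int[mu]_(u in `[q, +oo[) (l * expR (- (l * u)))%:E = (expR (- (l * q)))%:E)%E.
Proof.
move=> l0; pose F u := -1 * expR (- l * u + 0).
have dF u : is_derive u (1 : R) F (l * expR (- (l * u))).
  have H := is_derive1M (is_derive_cst (-1 : R) u (1 : R))
    (is_derive1_comp (is_derive_expR _) (is_derive1_affine (- l) 0 u)).
  by apply: (is_derive_eq H); rewrite mul0r add0r addr0 /cst mulrN mulN1r opprK mulNr mulrC.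
have cF : continuous F by exact: is_derive1_continuous.
rewrite (@ge0_continuous_FTC2y _ _ F _ 0).
- by rewrite /F addr0 mulN1r mulNr sub0e -EFinN opprK.
- by move=> x _; rewrite mulr_ge0 ?expR_ge0// ltW.
- apply: continuous_subspaceT => x.
  have E : (fun u => l * expR (- (l * u))) = (fun u => l * expR (- l * u + 0)).
    by apply/funext => v; rewrite addr0 mulNr.
  rewrite E; apply: cvgMr.
  exact: (is_derive1_continuous (fun t => is_derive1_comp (is_derive_expR _) (is_derive1_affine (- l) 0 t))).
- have ul : u * l @[u --> +oo] --> +oo by apply: gt0_cvgMly => //; exact: cvg_id.
  have -> : F = (fun u => -1 * expR (- (u * l))).
    by apply/funext => u; rewrite /F addr0 !mulN1r mulNr [l * u]mulrC.
  rewrite -[X in _ --> X](mulr0 (-1)); apply: cvgMr.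
  exact: (cvg_comp _ _ ul (@cvgr_expR R)).
- by move=> x _; have := dF x => ?; exact: ex_derive.
- by apply: cvg_at_right_filter; exact: cF.
- by move=> x _; rewrite derive1E; have := dF x => ?; exact: derive_val.
Qed.

End planar_normal.

Section leb2_sigma_finite.
Context {R : realType}.
Local Notation MR := (measurableTypeR R).
Local Notation mu := (@lebesgue_measure R).

Let square n : set MR := [set` `[- n%:R, n%:R : R]].

Lemma leb2_sigma_finite : sigma_finite setT (mu \x mu)%E.
Proof.
exists (fun n => square n `*` square n).
  apply/esym/seteqP; split => // -[x y] _.
  have [k xk] : exists k : nat, `|x| + `|y| <= k%:R.
    by exists (Num.truncn (`|x| + `|y|)).+1; rewrite ltW// truncnS_gt.
  exists k => //; split; rewrite /square /= in_itv/= -ler_norml;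
    by apply: le_trans xk; rewrite ?lerDl ?lerDr.
move=> n; have mI : measurable (square n) by exact: measurable_itv.
split; first exact: measurableX.
have muI : mu (square n) = (n%:R + n%:R : R)%:E.
  rewrite /square lebesgue_measure_itv/= lte_fin; case: ifPn => [_|].
    by rewrite -EFinD opprK.
  by rewrite -leNgt => nn; congr EFin; have := ler0n R n; lra.
by rewrite product_measure1E// [X in (X * _)%E]muI [X in (_ * X)%E]muI -EFinM ltry.
Qed.

End leb2_sigma_finite.

Section planar_tail.
Context {R : realType}.
Local Notation MR := (measurableTypeR R).
Local Notation mu := (@lebesgue_measure R).
Implicit Types (x y a b c t u : R).
Variables (s : R) (s0 : 0 < s).

Let K : R := (s * Num.sqrt (pi * 2)) ^- 2.
Let l : R := (2 * s ^+ 2)^-1.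
Let A : \bar R := leb2 [set z : R * R | (sqn z <= 1)%R].

Let K0 : 0 <= K. Proof. by rewrite invr_ge0 sqr_ge0. Qed.
Let l0 : 0 < l. Proof. by rewrite invr_gt0 mulr_gt0// exprn_gt0. Qed.

Let f t u : \bar R := ((K * (l * expR (- (l * u))) * Num.max (u - t) 0)%:E * A)%E.

Let f_ge0 t u : (0 <= f t u)%E.
Proof.
rewrite mule_ge0 ?measure_ge0// lee_fin !mulr_ge0 ?expR_ge0 ?(ltW l0)//.
by rewrite le_max lexx orbT.
Qed.

Let mle : measurable_fun [set: MR] (fun u : R => l * expR (- (l * u))).
Proof.
apply: measurable_funM => //.
by apply: (measurableT_comp (@measurable_expR R)); apply: measurableT_comp.
Qed.

Let mexp : measurable_fun [set: MR] (fun u : R => K * (l * expR (- (l * u)))).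
Proof. by apply: measurable_funM => //; exact: mle. Qed.

(** The normal density is a superposition of indicators of discs, and the
    integrals can be exchanged by Tonelli. *)
Let normal2_annuli t : 0 <= t ->
  (normal2 s [set z : R * R | (t < sqn z)%R] = \int[mu]_u f t u)%E.
Proof.
move=> t0.
pose D : set (MR * MR) := [set z | t < sqn z].
have mD : measurable D by exact: measurable_sqn_gt.
(* The pairs (z, u) with z in the annulus [t < sqn z <= u]. *)
pose E : set ((MR * MR) * MR) := [set p | t < sqn p.1 /\ sqn p.1 - p.2 <= 0].
have msq : measurable_fun [set: (MR * MR) * MR] (fun p : (R * R) * R => sqn p.1).
  exact: (measurableT_comp measurable_sqn measurable_fst).
have mE : measurable E.
  have -> : E = ((fun p : (R * R) * R => sqn p.1) @^-1` `]t, +oo[) `&`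
                ((fun p : (R * R) * R => sqn p.1 - p.2) @^-1` `]-oo, 0]).
    by apply/seteqP; split => p /=; rewrite !in_itv/= andbT.
  apply: measurableI; rewrite -[X in measurable X]setTI.
    exact: msq.
  have : measurable_fun [set: (MR * MR) * MR] (fun p : (R * R) * R => sqn p.1 - p.2).
    by apply: measurable_funB; [exact: msq|exact: measurable_snd].
  by apply.
pose H (p : (MR * MR) * MR) : \bar R := ((K * (l * expR (- (l * p.2))))%:E * (\1_E p)%:E)%E.
have H0 p : (0 <= H p)%E.
  by rewrite mule_ge0// lee_fin ?mulr_ge0 ?expR_ge0// ltW.
have mH : measurable_fun [set: (MR * MR) * MR] H.
  apply: emeasurable_funM; apply/measurable_EFinP.
    exact: (measurableT_comp mexp measurable_snd).
  exact: measurable_indic.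
transitivity (\int[mu \x mu]_z \int[mu]_u H (z, u))%E.
  rewrite -[LHS]mul1e -(@integral_cst _ _ _ (normal2 s) _ mD 1%E) integral_mkcond.
  have -> : (\int[normal2 s]_z (cst 1%E \_ D) z = \int[normal2 s]_z (\1_D z)%:E)%E.
    by apply: eq_integral => z _; rewrite patchE indicE; case: ifPn.
  rewrite ge0_integral_normal2//; last first.
    by apply/measurable_EFinP; exact: measurable_indic.
  apply: eq_integral => -[x y] _; set z := (x, y).
  rewrite indicE; case: (boolP (z \in D)) => zD; last first.
    rewrite mul0e; apply/esym; rewrite integral0_eq// => u _.
    rewrite /H indicE memNset ?mule0// => -[/= tz _].
    by move/negP : zD; apply; rewrite inE.
  rewrite mul1e normal_pdf2// -/K -/l -/z EFinM -integral_expR_tail//.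
  rewrite -ge0_integralZl//; last 2 first.
  - by apply/measurable_funTS/measurable_EFinP; exact: mle.
  - by move=> u _; rewrite lee_fin mulr_ge0 ?expR_ge0// ltW.
  rewrite integral_mkcond; apply: eq_integral => u _.
  rewrite patchE /H /= indicE.
  have -> : ((z, u) \in E) = (u \in `[sqn z, +oo[%classic).
    apply/idP/idP; rewrite !inE /E /= in_itv/= andbT subr_le0; first by case.
    by move=> zu; split => //; move: zD; rewrite inE.
  by case: ifPn => _; rewrite ?mule1 ?mule0 ?EFinM.
pose leb : {sigma_finite_measure set (MR * MR)%type -> \bar R} :=
  HB.pack (mu \x mu)%E
    (Measure_isSigmaFinite.Build _ _ _ (mu \x mu)%E leb2_sigma_finite).
rewrite [LHS](@sfinite_Fubini _ _ _ _ _ leb mu H)//.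
apply: eq_integral => u _; rewrite /H/=.
pose S : set (MR * MR) := [set z | t < sqn z <= u].
have mS : measurable S.
  have -> : S = D `&` [set z | sqn z <= u].
    by apply/seteqP; split => z; rewrite /S /D /=; [move=> /andP[]|move=> [-> ->]].
  by apply: measurableI => //; exact: measurable_sqn_le.
have SE z : \1_E (z, u) = \1_S z :> R.
  rewrite !indicE; congr (_%:R); congr nat_of_bool.
  apply/idP/idP; rewrite !inE /E /S /= subr_le0; first by move=> [-> ->].
  by move=> /andP[].
under eq_integral do rewrite SE.
rewrite ge0_integralZl//.
- rewrite integral_indic// setIT [X in (_ * X)%E](leb2_annulus u t0) -/A.
  by rewrite /f muleA -EFinM.
- by apply/measurable_EFinP; exact: measurable_indic.
- by rewrite lee_fin !mulr_ge0 ?expR_ge0// ltW.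
Qed.

(** With [f t u] the contribution of the annulus [t < sqn z <= u], the tail is
    the integral of [f t u] in [u].  Translating [u] by [t] multiplies [f]
    by [exp (- l t)], and the integral of [f 0] is the total mass of the plane
    without the origin, which is 1. *)
Lemma normal2_tail t : 0 <= t ->
  normal2 s [set z : R * R | (t < sqn z)%R] = (expR (- (l * t)))%:E.
Proof.
move=> t0.
have mf u : measurable_fun [set: R] (f u).
  apply: emeasurable_funM => //; apply/measurable_EFinP; apply: measurable_funM.
    exact: mexp.
  by apply: measurable_maxr => //; exact: measurable_funB.
have shift : (\int[mu]_u f t u = (expR (- (l * t)))%:E * \int[mu]_u f 0 u)%E.
  rewrite -(ge0_integral_translate t (mf t) (f_ge0 t)) -ge0_integralZl//.
  - apply: eq_integral => u _; rewrite /f muleA -EFinM; congr (_%:E * _)%E.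
    by rewrite addrK subr0 mulrDr opprD expRD; ring.
  - exact: mf.
have N0 : normal_prob 0 s [set (0 : R)] = 0%E by rewrite /normal_prob integral_set1.
have tot : (\int[mu]_u f 0 u = 1)%E.
  rewrite -normal2_annuli//.
  pose O : set MR := [set (0 : R)].
  have mO : measurable O by exact: measurable_set1.
  have -> : [set z : R * R | 0 < sqn z] = ~` (O `*` O).
    apply/seteqP; split => -[x y] /=; rewrite /sqn/=.
      by move=> H [x0 y0]; move: H; rewrite x0 y0 expr0n addr0 ltxx.
    move=> H; rewrite lt_neqAle addr_ge0 ?sqr_ge0// andbT eq_sym.
    rewrite paddr_eq0 ?sqr_ge0// !sqrf_eq0; apply/negP => /andP[/eqP x0 /eqP y0].
    by apply: H.
  have E0 : (normal_prob 0 s \x normal_prob 0 s)%E (O `*` O) = 0%E.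
    by rewrite product_measure1E// [X in (X * _)%E]N0 mul0e.
  rewrite /normal2 probability_setC; last exact: measurableX.
  by rewrite [X in (_ - X)%E]E0 sube0.
by rewrite normal2_annuli// shift tot mule1.
Qed.

End planar_tail.

(** * Variances of gaussian variables *)

Section second_moment.
Context {R : realType}.
Local Notation MR := (measurableTypeR R).
Local Notation mu := (@lebesgue_measure R).
Implicit Types (x y a b c t u : R).

(** The integral of [x^2 + y^2] under the planar normal law is twice the
    wanted value; it is also the integral of the tail of [x^2 + y^2], which is
    a known exponential. *)
Lemma integral_normal_sqr s : 0 < s ->
  (\int[normal_prob 0 s]_x ((x : R) ^+ 2)%:E = (s ^+ 2)%:E)%E.
Proof.
move=> s0; set I := (\int[_]_x _)%E.
pose nu : probability (MR * MR)%type R := (normal_prob 0 s \x normal_prob 0 s)%E.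
have msq : measurable_fun [set: MR * MR] (fun z : R * R => (sqn z)%:E).
  by apply/measurable_EFinP; exact: measurable_sqn.
have sq0 (z : R * R) : (0 <= (sqn z)%:E)%E by rewrite lee_fin sqn_ge0.
have mx2 : measurable_fun [set: MR] (fun x : R => (x ^+ 2)%:E).
  by apply/measurable_EFinP; exact: measurable_funX.
have x20 x : (0 <= (x ^+ 2)%:E)%E by rewrite lee_fin sqr_ge0.
have I0 : (0 <= I)%E by exact: integral_ge0.
(* [x^2 + y^2] integrates to the sum of two equal terms. *)
have J1 : (\int[nu]_z (sqn (z : R * R))%:E = I + I)%E.
  rewrite [LHS](fubini_tonelli1 (m1 := normal_prob 0 s) (m2 := normal_prob 0 s))//.
  transitivity (\int[normal_prob 0 s]_x (((x : R) ^+ 2)%:E + I))%E.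
    apply: eq_integral => x _; rewrite /fubini_F /sqn/=.
    under eq_integral do rewrite EFinD.
    rewrite ge0_integralD//; congr (_ + _)%E.
    rewrite integral_cst// -[RHS]mule1; congr (_ * _)%E.
    exact: (@probability_setT _ _ _ (normal_prob 0 s)).
  rewrite ge0_integralD//; congr (_ + _)%E.
  rewrite integral_cst// -[RHS]mule1; congr (_ * _)%E.
  exact: (@probability_setT _ _ _ (normal_prob 0 s)).
have l0 : 0 < (2 * s ^+ 2)^-1 by rewrite invr_gt0 mulr_gt0// exprn_gt0.
pose l := (2 * s ^+ 2)^-1.
(* [sqn z] is the length of the set of [u >= 0] less than [sqn z]; exchanging
   the integrals gives the integral of the tail. *)
have J2 : (\int[nu]_z (sqn (z : R * R))%:E = (2 * s ^+ 2)%:E)%E.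
  pose E : set ((MR * MR) * MR) := [set p | 0 <= p.2 /\ 0 < sqn (p.1 : R * R) - p.2].
  have mE : measurable E.
    have -> : E = ((fun p : (R * R) * R => p.2) @^-1` `[0, +oo[) `&`
                  ((fun p : (R * R) * R => sqn p.1 - p.2) @^-1` `]0, +oo[).
      by apply/seteqP; split => p /=; rewrite !in_itv/= !andbT.
    apply: measurableI; rewrite -[X in measurable X]setTI.
      exact: measurable_snd.
    have : measurable_fun [set: (MR * MR) * MR] (fun p : (R * R) * R => sqn p.1 - p.2).
      apply: measurable_funB; last exact: measurable_snd.
      exact: (measurableT_comp measurable_sqn measurable_fst).
    by apply.
  pose H (p : (MR * MR) * MR) : \bar R := (\1_E p)%:E.
  transitivity (\int[nu]_z \int[mu]_u H (z, u))%E.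
    apply: eq_integral => z _.
    pose I0z : set MR := [set` `[(0 : R), sqn z[].
    have mI0z : measurable I0z by exact: measurable_itv.
    have muI0z : mu I0z = (sqn z)%:E.
      rewrite /I0z lebesgue_measure_itv/= lte_fin.
      case: ifPn => [_|]; first by rewrite sube0.
      rewrite -leNgt => z0; congr EFin; apply/eqP; rewrite eq_le z0.
      by rewrite sqn_ge0.
    transitivity (\int[mu]_u (\1_I0z u)%:E)%E.
      by rewrite integral_indic// setIT -muI0z.
    apply: eq_integral => u _; rewrite /H !indicE; congr ((_%:R)%:E).
    congr nat_of_bool; apply/idP/idP; rewrite !inE /E /I0z /= in_itv/= subr_gt0.
      by move=> /andP[].
    by move=> [-> ->].
  rewrite (@sfinite_Fubini _ _ _ _ _ nu mu H)//; last 2 first.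
  - by move=> p; rewrite lee_fin.
  - by apply/measurable_EFinP; exact: measurable_indic.
  transitivity (\int[mu]_(u in `[0%R, +oo[) (expR (- (l * u)))%:E)%E.
    rewrite [RHS]integral_mkcond; apply: eq_integral => u _.
    pose S : set (MR * MR) := [set z | u < sqn (z : R * R)].
    have mS : measurable S by exact: measurable_sqn_gt.
    rewrite patchE (_ : (u \in _) = (0 <= u)); last first.
      by apply/idP/idP; rewrite inE/= in_itv/= andbT.
    case: ifPn => u0.
      rewrite -normal2_tail// -[RHS]/(nu S) -[X in nu X]setIT -integral_indic//.
      apply: eq_integral => z _; rewrite /H !indicE; congr ((_%:R)%:E).
      congr nat_of_bool; apply/idP/idP; rewrite !inE /E /S /= subr_gt0.
        by case.
      by [].
    rewrite integral0_eq// => z _; rewrite /H indicE memNset// => -[/= u0' _].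
    by move: u0; rewrite u0'.
  have ml : measurable_fun ([set` `[(0 : R), +oo[] : set MR) (fun u : R => (expR (- (l * u)))%:E).
    apply/measurable_EFinP; apply: measurable_funTS.
    apply: (measurableT_comp (@measurable_expR R)); apply: measurableT_comp => //.
  have := integral_expR_tail 0 l0.
  rewrite mulr0 oppr0 expR0; under eq_integral do rewrite EFinM.
  rewrite ge0_integralZl ?lee_fin ?(ltW l0)//.
  move=> /(congr1 (fun w => (2 * s ^+ 2)%:E * w)%E).
  rewrite muleA -EFinM mulfV ?mul1e ?mule1//.
  by rewrite gt_eqF// mulr_gt0// exprn_gt0.
have : (I + I = (2 * s ^+ 2)%:E)%E by rewrite -J1 J2.
clear J1 J2; move: (I) I0 => [i _| |]//=.
by rewrite -EFinD => -[] ii; congr EFin; lra.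
Qed.

Context d (T : measurableType d) (P : probability T R).

Lemma gaussian_sqr (X : {mfun T >-> R}) v : is_gaussian P X 0 v ->
  (\int[P]_w (X w ^+ 2)%:E = v%:E)%E.
Proof.
move=> gX; have v0 : 0 <= v by case: gX.
rewrite (ge0_integral_gaussian (f := fun x => (x ^+ 2)%:E) gX).
- case: ifPn => [/eqP ->|vn0]; first by rewrite expr0n.
  rewrite integral_normal_sqr ?sqr_sqrtr//.
  by rewrite sqrtr_gt0 lt_neqAle eq_sym vn0.
- by apply/measurable_EFinP; exact: measurable_funX.
- by move=> x; rewrite lee_fin sqr_ge0.
Qed.

(** Identifies the variance that the gaussian pair property only asserts to
    exist. *)
Lemma variance_gaussian (X : {mfun T >-> R}) v : is_gaussian P X 0 v ->
  covariance P X X = v%:E.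
Proof.
move=> gX.
have v0 : 0 <= v by case: gX.
(* The mean vanishes because the normal density is even. *)
have EX : fine ('E_P[X])%E = 0.
  rewrite unlock integralE.
  have mid : measurable_fun [set: R] (@EFin R).
    by apply/measurable_EFinP; exact: measurable_id.
  rewrite -[(fun w => (X w)%:E)]/((@EFin R) \o X) funepos_comp funeneg_comp.
  rewrite (ge0_integral_gaussian gX (measurable_funepos mid))//.
  rewrite (ge0_integral_gaussian gX (measurable_funeneg mid))//.
  case: ifPn => vn0.
    by rewrite funeposE funenegE -EFinN oppr0 maxxx /= subr0.
  rewrite -integralE.
  have sv : 0 < Num.sqrt v by rewrite sqrtr_gt0 lt_neqAle eq_sym vn0.
  by rewrite -[LHS]/(\int[normal_prob 0 (Num.sqrt v)]_x x) (Rintegral_normal_odd sv).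
rewrite unlock EX unlock -(gaussian_sqr gX).
by apply: eq_integral => w _ /=; rewrite !fctE/= !subr0 expr2.
Qed.

(** A gaussian law determines its variance, so the variance of a multiple of
    [X] can only be the expected one. *)
Lemma is_gaussianZ_var (X : {mfun T >-> R}) (c v v' : R) :
  is_gaussian P X 0 v -> is_gaussian P (c *: X) 0 v' -> v' = c ^+ 2 * v.
Proof.
move=> gX /gaussian_sqr E; apply: EFin_inj; rewrite -E EFinM -(gaussian_sqr gX).
rewrite -ge0_integralZl//.
- by apply: eq_integral => w _; rewrite -EFinM -exprMn.
- by apply/measurable_EFinP; exact: measurable_funX.
- by move=> w _; rewrite lee_fin sqr_ge0.
- by rewrite lee_fin sqr_ge0.
Qed.

End second_moment.

(** * Kernels on a disc *)

Section kernels.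
Context {R : realType}.
Local Notation MR := (measurableTypeR R).
Local Notation mu := (@lebesgue_measure R).
Local Notation mu2 := (mu \x mu)%E.
Variables (r : R) (r0 : 0 < r).
Local Notation B := (disc r).
Implicit Types (k f g h : R * R -> R).

Lemma discE : B = [set z | sqn z <= r ^+ 2].
Proof.
apply/seteqP; split => z; rewrite /disc/= /enorm -/(sqn z).
  by move=> zr; rewrite -(sqr_sqrtr (sqn_ge0 z)) ler_sqr ?nnegrE ?sqrtr_ge0// ltW.
by move=> zr; rewrite -[leRHS]gtr0_norm// -sqrtr_sqr ler_wsqrtr.
Qed.

Lemma measurable_disc : measurable (B : set (MR * MR)).
Proof. by rewrite discE; exact: measurable_sqn_le. Qed.

Lemma leb2_disc_fin : (mu2 B < +oo)%E.
Proof.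
rewrite discE [X in (X < _)%E](leb2_sqn_le (exprn_gt0 2 r0)) ltey_eq fin_numM//.
exact: leb2_sqn_le1_fin.
Qed.

(** Bounded on the disc, hence square integrable there since the disc has
    finite area. *)
Definition bounded_kernel k := measurable_fun [set: MR * MR] k /\
  exists M, forall z, B z -> `|k z| <= M.

Lemma bounded_kernel_lin a b k h : bounded_kernel k -> bounded_kernel h ->
  bounded_kernel (fun z => a * k z + b * h z).
Proof.
move=> [mk [M kM]] [mh [N hN]]; split.
  by apply: measurable_funD; exact: measurable_funM.
exists (`|a| * M + `|b| * N) => z Bz.
by rewrite (le_trans (ler_normD _ _))// !normrM lerD// ler_wpM2l// ?kM ?hN.
Qed.

Lemma bounded_kernelM k h : bounded_kernel k -> bounded_kernel h ->
  bounded_kernel (fun z => k z * h z).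
Proof.
move=> [mk [M kM]] [mh [N hN]]; split; first exact: measurable_funM.
exists (M * N) => z Bz; rewrite normrM ler_pM// ?kM ?hN//.
Qed.

Lemma bounded_kernel_cst a : bounded_kernel (fun=> a).
Proof. by split => //; exists `|a|. Qed.

Lemma bounded_kernel_x : bounded_kernel (fun z => z.1).
Proof.
split; first exact: measurable_fst.
exists r => z; rewrite discE /= => zr.
rewrite -[leRHS]gtr0_norm// -ler_sqr ?nnegrE// !real_normK ?num_real//.
by apply: le_trans zr; rewrite lerDl sqr_ge0.
Qed.

Lemma bounded_kernel_y : bounded_kernel (fun z => z.2).
Proof.
split; first exact: measurable_snd.
exists r => z; rewrite discE /= => zr.
rewrite -[leRHS]gtr0_norm// -ler_sqr ?nnegrE// !real_normK ?num_real//.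
by apply: le_trans zr; rewrite lerDr sqr_ge0.
Qed.

Lemma bounded_kernel_integrable k : bounded_kernel k ->
  mu2.-integrable (B : set (MR * MR)) (EFin \o k).
Proof.
move=> [mk [M kM]]; apply: measurable_bounded_integrable.
- exact: measurable_disc.
- exact: leb2_disc_fin.
- exact: measurable_funTS.
- exists M; split; first exact: num_real.
  by move=> N MN z Bz; rewrite /= (le_trans (kM z Bz))// ltW.
Qed.

(** The scalar product of L^2 of the disc. *)
Definition dotp k h : R := \int[mu2]_(z in B) (k z * h z).

Lemma dotpC k h : dotp k h = dotp h k.
Proof. by apply: eq_Rintegral => z _; rewrite mulrC. Qed.

Lemma dotp_linl a b k h g : bounded_kernel k -> bounded_kernel h -> bounded_kernel g ->
  dotp (fun z => a * k z + b * h z) g = a * dotp k g + b * dotp h g.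
Proof.
move=> ak ah ag.
have ikg : mu2.-integrable (B : set (MR * MR)) (EFin \o (fun z => k z * g z)).
  by apply: bounded_kernel_integrable; exact: bounded_kernelM.
have ihg : mu2.-integrable (B : set (MR * MR)) (EFin \o (fun z => h z * g z)).
  by apply: bounded_kernel_integrable; exact: bounded_kernelM.
have mB := measurable_disc.
rewrite -(RintegralZl a mB ikg) -(RintegralZl b mB ihg) -RintegralD//.
- by apply: eq_Rintegral => z _; ring.
- exact: (integrableZl mB a ikg).
- exact: (integrableZl mB b ihg).
Qed.

Lemma dotp_reflect (phi : MR * MR -> MR * MR) k h :
  measurable_fun [set: MR * MR] phi ->
  (forall A, measurable A -> leb2 (phi @^-1` A) = leb2 A) ->
  (forall z, B (phi z) <-> B z) ->
  bounded_kernel k -> bounded_kernel h ->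
  dotp (k \o phi) (h \o phi) = dotp k h.
Proof.
move=> mphi phi2 Bphi [mk _] [mh _].
rewrite /dotp Rintegral_mkcond [RHS]Rintegral_mkcond.
rewrite -(@Rintegral_preserving _ (MR * MR)%type R mu2 phi mphi phi2
  ((fun z => k z * h z) \_ B)).
- apply: eq_Rintegral => z _; rewrite !patchE.
  have -> : (phi z \in B) = (z \in B).
    by apply/idP/idP; rewrite !inE => /Bphi.
  by case: ifP.
- apply/(measurable_restrictT _ _).1; first exact: measurable_disc.
  by apply: measurable_funTS; exact: measurable_funM.
Qed.

Let measurable_negx : measurable_fun [set: MR * MR] (fun z : MR * MR => (- z.1, z.2) : MR * MR).
Proof.
apply: measurable_fun_pair; last exact: measurable_snd.
exact: (measurableT_comp (@oppr_measurable R setT) measurable_fst).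
Qed.

(** The reflection [x -> - x] preserves the disc and the area, and changes
    the sign of the integrand. *)
Lemma dotp_oddx k h : bounded_kernel k -> bounded_kernel h ->
  (forall x y, k (- x, y) * h (- x, y) = - (k (x, y) * h (x, y))) -> dotp k h = 0.
Proof.
move=> ak ah kh.
have := @dotp_reflect (fun z : MR * MR => (- z.1, z.2)) k h measurable_negx.
move=> /(_ _ _ ak ah) H.
have {H} : dotp (k \o (fun z : MR * MR => (- z.1, z.2) : MR * MR))
    (h \o (fun z : MR * MR => (- z.1, z.2) : MR * MR)) = dotp k h.
  apply: H => [A mA|z]; last by rewrite discE /sqn /= sqrrN.
  have pN (C D : set MR) : measurable C -> measurable D ->
      (1%:E * (mu (-%R @^-1` C) * mu (idfun @^-1` D)) = mu C * mu D :> \bar R)%E.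
    by move=> mC mD; rewrite mul1e; congr (_ * _)%E; exact: lebesgue_measureN.
  rewrite -[RHS](@leb2_map _ -%R idfun A 1 ler01 (@oppr_measurable R setT)
    (@measurable_id _ R setT) pN mA).
  by rewrite mul1e.
have -> : dotp (k \o (fun z : MR * MR => (- z.1, z.2) : MR * MR))
    (h \o (fun z : MR * MR => (- z.1, z.2) : MR * MR)) = - dotp k h.
  rewrite -mulN1r -RintegralZl; last 2 first.
  - exact: measurable_disc.
  - by apply: bounded_kernel_integrable; exact: bounded_kernelM.
  by apply: eq_Rintegral => -[x y] _; rewrite /= kh mulN1r.
lra.
Qed.

Lemma dotp_swap k h : bounded_kernel k -> bounded_kernel h ->
  dotp (k \o swap_pair) (h \o swap_pair) = dotp k h.
Proof.
apply: (@dotp_reflect (@swap_pair MR MR)).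
- exact: measurable_fun_pair.
- exact: leb2_swap.
- by move=> z; rewrite discE /sqn/= addrC.
Qed.

(** The integrand is bounded below on the rectangle
    [r/4 <= x <= r/2], [0 <= y <= r/2], which lies in the disc. *)
Lemma dotp_xx_gt0 : 0 < dotp (fun z => z.1) (fun z => z.1).
Proof.
have mB := measurable_disc.
pose I1 : set MR := [set` `[r / 4, r / 2]].
pose I2 : set MR := [set` `[0, r / 2]].
have mI1 : measurable I1 by exact: measurable_itv.
have mI2 : measurable I2 by exact: measurable_itv.
have muI1 : mu I1 = (r / 4)%:E.
  rewrite /I1 lebesgue_measure_itv/= lte_fin ifT; last by have := r0; lra.
  by rewrite -EFinB; congr EFin; field.
have muI2 : mu I2 = (r / 2)%:E.
  rewrite /I2 lebesgue_measure_itv/= lte_fin ifT; last by have := r0; lra.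
  by rewrite sube0.
have muI : mu2 (I1 `*` I2) = (r / 4 * (r / 2))%:E.
  by rewrite product_measure1E// [X in (X * _)%E]muI1 [X in (_ * X)%E]muI2.
have IB : I1 `*` I2 `<=` B.
  move=> [x y] /=; rewrite /I1 /I2 /= !in_itv/= => -[/andP[x1 x2] /andP[y1 y2]].
  rewrite discE /= /sqn/=.
  have rr := r0; have r4 : 0 <= r / 4 by lra.
  have x0 : 0 <= x by lra.
  have h1 : x ^+ 2 <= (r / 2) ^+ 2 by rewrite ler_sqr ?nnegrE//; lra.
  have h2 : y ^+ 2 <= (r / 2) ^+ 2 by rewrite ler_sqr ?nnegrE//; lra.
  nra.
pose f (z : MR * MR) : \bar R := ((z : R * R).1 * (z : R * R).1)%:E.
have mf : measurable_fun [set: MR * MR] f.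
  by apply/measurable_EFinP; apply: measurable_funM; exact: measurable_fst.
have f0 z : (0 <= f z)%E by rewrite lee_fin -expr2 sqr_ge0.
have low : (((r / 4) ^+ 2 * (r / 4 * (r / 2)))%:E <= \int[mu2]_(z in B) f z)%E.
  apply: (@le_trans _ _ (\int[mu2]_(z in I1 `*` I2) f z)%E).
    apply: (@le_trans _ _ (\int[mu2]_(z in I1 `*` I2) ((r / 4) ^+ 2)%:E)%E).
      rewrite integral_cst; last exact: measurableX.
      by rewrite [X in (_ <= _ * X)%E]muI -EFinM.
    apply: ge0_le_integral => //.
    - exact: measurableX.
    - by move=> z _; rewrite lee_fin sqr_ge0.
    - exact: measurable_funTS.
    - move=> [x y] /=; rewrite /I1 /= in_itv/= => -[/andP[x1 _] _].
      have rr := r0; have r4 : 0 <= r / 4 by lra.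
      by rewrite lee_fin -expr2 ler_sqr ?nnegrE// (le_trans r4).
  apply: ge0_subset_integral => //; first exact: measurableX.
  exact: measurable_funTS.
have fin : (\int[mu2]_(z in B) f z)%E \is a fin_num.
  apply: integrable_fin_num => //.
  by apply: bounded_kernel_integrable; apply: bounded_kernelM; exact: bounded_kernel_x.
rewrite -lte_fin /dotp /Rintegral fineK//; apply: lt_le_trans low.
by rewrite lte_fin !mulr_gt0// ?exprn_gt0 ?divr_gt0.
Qed.

End kernels.

Section window_integrals.
Context {R : realType}.
Local Notation MR := (measurableTypeR R).
Local Notation mu := (@lebesgue_measure R).
Local Notation mu2 := (mu \x mu)%E.
Variables (r u v : R) (r0 : 0 < r).
Local Notation B := (disc r).
Local Notation win := (window r u v).
Implicit Types (k f g h : R * R -> R).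

Lemma window_lin a b k h :
  win (fun z => a * k z + b * h z) = (fun z => a * win k z + b * win h z).
Proof. by apply/funext => z; rewrite /window/=; ring. Qed.

Let shift (z : MR * MR) : MR * MR := (z.1 - u, z.2 - v).

Let mshift : measurable_fun [set: MR * MR] shift.
Proof.
by apply: measurable_fun_pair; apply: measurable_funB.
Qed.

Let shift_mu2 (A : set (R * R)) : measurable (A : set (MR * MR)) ->
  leb2 (shift @^-1` A) = leb2 A.
Proof.
move=> mA.
have pD (C D : set MR) : measurable C -> measurable D ->
    (1%:E * (mu ((fun x : R => (x - u)%R) @^-1` C) * mu ((fun x : R => (x - v)%R) @^-1` D)) =
     mu C * mu D :> \bar R)%E.
  by move=> mC mD; rewrite mul1e; congr (_ * _)%E; exact: lebesgue_measure_translate.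
have mB w : measurable_fun [set: R] (fun x : R => x - w) by exact: measurable_funB.
by rewrite -[RHS](@leb2_map _ _ _ A 1 ler01 (mB u) (mB v) pD mA) mul1e.
Qed.

Let m1B : measurable_fun [set: MR * MR] (\1_B : R * R -> R).
Proof. by apply: measurable_indic; exact: measurable_disc. Qed.

Lemma measurable_window k : measurable_fun [set: MR * MR] k ->
  measurable_fun [set: MR * MR] (win k).
Proof.
move=> mk; apply: measurable_funM.
  exact: (measurableT_comp mk mshift).
exact: (measurableT_comp m1B mshift).
Qed.

(** Windows are translates of kernels cut off to the disc, and area is
    invariant under translation. *)
Lemma Rintegral_window k h : bounded_kernel r k -> bounded_kernel r h ->
  \int[leb2]_z (win k z * win h z) = dotp r k h.
Proof.
move=> [mk _] [mh _].
rewrite /dotp [RHS]Rintegral_mkcond.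
have mkhB : measurable_fun [set: MR * MR] ((fun z => k z * h z) \_ B).
  apply/(measurable_restrictT _ _).1; first exact: measurable_disc.
  by apply: measurable_funTS; exact: measurable_funM.
transitivity (\int[mu2]_z ((fun z => k z * h z) \_ B) (shift z)).
  apply: eq_Rintegral => z _.
  rewrite -[LHS]/(k (shift z) * \1_B (shift z) * (h (shift z) * \1_B (shift z))).
  rewrite patchE indicE.
  by case: ifPn => _; rewrite ?mulr1 ?mulr0 ?mul0r.
exact: (@Rintegral_preserving _ (MR * MR)%type R mu2 shift mshift shift_mu2).
Qed.

Lemma window_Lfun k : bounded_kernel r k -> win k \in Lfun leb2 2%:E.
Proof.
move=> ak; have [mk [M kM]] := ak.
have mw := measurable_window mk.
rewrite inE; apply/andP; split; first by rewrite inE.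
rewrite !inE/= /finite_norm unlock /Lnorm poweR_lty//=.
(* The square of the window is at most [M^2] on a translate of the disc. *)
pose g (z : R * R) : \bar R := ((M ^+ 2)%:E * (\1_B z)%:E)%E.
have mg : measurable_fun [set: MR * MR] g.
  by apply: emeasurable_funM => //; exact/measurable_EFinP.
have g0 z : (0 <= g z)%E by rewrite mule_ge0// lee_fin ?sqr_ge0.
apply: (@le_lt_trans _ _ (\int[mu2]_z g (shift z))%E).
  apply: ge0_le_integral => //.
  - apply/measurable_EFinP.
    apply: (@measurableT_comp _ _ _ _ _ _ (fun x : R => x `^ 2)) => //.
    exact: measurableT_comp.
  - exact: (measurableT_comp mg mshift).
  - move=> z _; rewrite /= powR_mulrn// /g lee_fin -[win k z]/(k (shift z) * \1_B (shift z)) indicE.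
    have [zB|zB] := boolP (shift z \in B); last by rewrite !mulr0 normr0 expr0n.
    rewrite !mulr1 ler_sqr ?nnegrE ?(le_trans _ (kM (shift z) _))//;
      by [apply: kM; rewrite inE in zB|rewrite inE in zB].
rewrite (@ge0_integral_preserving _ (MR * MR)%type R mu2 shift mshift shift_mu2)//.
rewrite ge0_integralZl//; [|exact/measurable_EFinP|by rewrite lee_fin sqr_ge0].
rewrite integral_indic// ?setIT; last exact: measurable_disc.
have := leb2_disc_fin r0; rewrite -ge0_fin_numE// => Bfin.
by rewrite ltey_eq fin_numM.
Qed.

End window_integrals.

(** * Independence of the Laplacian and the gradient *)

Section noise.
Context {R : realType} d {T : measurableType d} (P : probability T R).
Local Notation MR := (measurableTypeR R).
Variables (sigma : R) (W : set (R * R) -> {RV P >-> R})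
  (J : (R * R -> R) -> {RV P >-> R}).
Hypothesis wienerJ : wiener_integral sigma W J.
Variables (r u v : R).
Hypothesis r0 : 0 < r.
Local Notation win := (window r u v).

(** The pair formed with itself gives gaussianity of multiples; the covariance
    gives the variance. *)
Lemma wiener_is_gaussianZ (c : R) h : h \in Lfun leb2 2%:E ->
  is_gaussian P (c *: (J h : {mfun T >-> R})) 0
    (c ^+ 2 * (sigma ^+ 2 * \int[leb2]_z (h z * h z))).
Proof.
move=> hL; have [pair cov] := wiener_gaussian wienerJ hL hL.
have [w gw] := pair 1 0; rewrite scale1r scale0r addr0 in gw.
have ww : w = sigma ^+ 2 * \int[leb2]_z (h z * h z).
  by apply: EFin_inj; rewrite -(variance_gaussian gw).
have [w' gw'] := pair c 0; rewrite scale0r addr0 in gw'.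
by rewrite -ww -(is_gaussianZ_var gw gw').
Qed.

Lemma window_gaussianZ (c : R) k : bounded_kernel r k ->
  is_gaussian P (c *: (J (win k) : {mfun T >-> R})) 0
    (c ^+ 2 * (sigma ^+ 2 * dotp r k k)).
Proof.
move=> ak; rewrite -(Rintegral_window u v r0 ak ak).
exact: (wiener_is_gaussianZ c (window_Lfun u v r0 ak)).
Qed.

Lemma window_gaussian k : bounded_kernel r k ->
  is_gaussian P (J (win k)) 0 (sigma ^+ 2 * dotp r k k).
Proof.
by move=> ak; have := window_gaussianZ 1 ak; rewrite scale1r expr1n mul1r.
Qed.

Let k1 (z : R * R) := alpha r + z.1 ^+ 2 + z.2 ^+ 2.
Let k2 (z : R * R) := z.1.
Let k3 (z : R * R) := z.2.

Let ak2 : bounded_kernel r k2. Proof. exact: bounded_kernel_x. Qed.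
Let ak3 : bounded_kernel r k3. Proof. exact: bounded_kernel_y. Qed.
Let ak1 : bounded_kernel r k1.
Proof.
have -> : k1 = fun z => 1 * (1 * alpha r + 1 * (k2 z * k2 z)) + 1 * (k3 z * k3 z).
  by apply/funext => z; rewrite /k1 /k2 /k3; ring.
exact: (bounded_kernel_lin _ _ (bounded_kernel_lin _ _ (bounded_kernel_cst r _)
  (bounded_kernelM ak2 ak2)) (bounded_kernelM ak3 ak3)).
Qed.

Let ortho12 : dotp r k1 k2 = 0.
Proof.
by apply: dotp_oddx => // x y; rewrite /k1 /k2 /= sqrrN mulrN.
Qed.

Let ortho23 : dotp r k2 k3 = 0.
Proof. by apply: dotp_oddx => // x y; rewrite /k2 /k3 /= mulNr. Qed.

Let ortho13 : dotp r k1 k3 = 0.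
Proof.
rewrite -(dotp_swap r0 ak1 ak3) -ortho12; apply: eq_Rintegral => z _.
by rewrite /k1 /k2 /k3 /=; ring.
Qed.

Let dotp22 : dotp r k2 k2 = bcoef r.
Proof.
by apply: eq_Rintegral => z _; rewrite /k2 expr0 mulr1 expr2.
Qed.

Let dotp33 : dotp r k3 k3 = bcoef r.
Proof. by rewrite -dotp22 -(dotp_swap r0 ak2 ak2). Qed.

Lemma bcoef_gt0 : 0 < bcoef r.
Proof. by rewrite -dotp22; exact: dotp_xx_gt0. Qed.

(** By orthogonality, the squared norm of a combination of the three kernels
    has no cross terms. *)
Let dotp_lin (c1 c2 c3 : R) :
  let K z := c1 * k1 z + 1 * (c2 * k2 z + c3 * k3 z) in
  dotp r K K = c1 ^+ 2 * dotp r k1 k1 + c2 ^+ 2 * bcoef r + c3 ^+ 2 * bcoef r.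
Proof.
have a23 := bounded_kernel_lin c2 c3 ak2 ak3.
have aK := bounded_kernel_lin c1 1 ak1 a23.
move=> K; rewrite /K (dotp_linl r0 c1 1 ak1 a23 aK).
rewrite (dotpC r k1) (dotpC r (fun z => c2 * k2 z + c3 * k3 z)).
rewrite (dotp_linl r0 c1 1 ak1 a23 ak1) (dotp_linl r0 c1 1 ak1 a23 a23).
rewrite (dotpC r k1 (fun z => c2 * k2 z + c3 * k3 z)).
rewrite !(dotp_linl r0 c2 c3 ak2 ak3) // .
rewrite (dotpC r k2 (fun z => c2 * k2 z + c3 * k3 z)).
rewrite (dotpC r k3 (fun z => c2 * k2 z + c3 * k3 z)).
rewrite (dotp_linl r0 c2 c3 ak2 ak3 ak2) (dotp_linl r0 c2 c3 ak2 ak3 ak3).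
rewrite (dotpC r k2 k1) (dotpC r k3 k1) (dotpC r k3 k2).
rewrite ortho12 ortho13 ortho23 dotp22 dotp33; ring.
Qed.

Let lapl : {mfun T >-> R} := noise_lapl J r u v.
Let dx : {mfun T >-> R} := noise_dx J r u v.
Let dy : {mfun T >-> R} := noise_dy J r u v.

Definition grad_var : R := sigma ^+ 2 / bcoef r.
Let lapl_var : R := (beta r)^-1 ^+ 2 * (sigma ^+ 2 * dotp r k1 k1).

Let var_dx : (bcoef r)^-1 ^+ 2 * (sigma ^+ 2 * bcoef r) = grad_var.
Proof. by rewrite /grad_var; field; rewrite gt_eqF// bcoef_gt0. Qed.

Lemma dx_gaussian : is_gaussian P dx 0 grad_var.
Proof.
have := window_gaussianZ (bcoef r)^-1 ak2.
rewrite dotp22 var_dx; exact.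
Qed.

Lemma dy_gaussian : is_gaussian P dy 0 grad_var.
Proof.
have := window_gaussianZ (bcoef r)^-1 ak3.
rewrite dotp33 var_dx; exact.
Qed.

Lemma lapl_gaussian : is_gaussian P lapl 0 lapl_var.
Proof. have := window_gaussianZ (beta r)^-1 ak1; exact. Qed.

(** Linearity of the Wiener integral for three terms.  The factor 1 puts the
    combination in the two-term shape to which linearity applies. *)
Let J_lin c1 c2 c3 : {ae P, forall w,
  J (win (fun z => c1 * k1 z + 1 * (c2 * k2 z + c3 * k3 z))) w =
  c1 * J (win k1) w + 1 * (c2 * J (win k2) w + c3 * J (win k3) w)}.
Proof.
have a23 := bounded_kernel_lin c2 c3 ak2 ak3.
have h1 := window_Lfun u v r0 ak1.
have h2 := window_Lfun u v r0 ak2.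
have h3 := window_Lfun u v r0 ak3.
have h23 := window_Lfun u v r0 a23.
have E1 := wiener_linear wienerJ c1 1 h1 h23.
have E2 := wiener_linear wienerJ c2 c3 h2 h3.
rewrite -window_lin in E1; rewrite -window_lin in E2.
by apply: filterS2 E1 E2 => w -> ->.
Qed.

(** A combination of the three variables is almost surely the Wiener integral
    of the combination of kernels, of which the law is known. *)
Let noise_char a1 a2 a3 th :
  (\int[P]_w (rcos (a1 * lapl w + a2 * dx w + a3 * dy w + th))%:E =
   (1 + cos th * gaussian_char (a1 ^+ 2 * lapl_var + a2 ^+ 2 * grad_var + a3 ^+ 2 * grad_var))%:E)%E.
Proof.
pose c1 := a1 * (beta r)^-1; pose c2 := a2 * (bcoef r)^-1; pose c3 := a3 * (bcoef r)^-1.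
pose K z := c1 * k1 z + 1 * (c2 * k2 z + c3 * k3 z).
have aK : bounded_kernel r K := bounded_kernel_lin c1 1 ak1 (bounded_kernel_lin c2 c3 ak2 ak3).
have gK := window_gaussian aK.
have dK : dotp r K K = c1 ^+ 2 * dotp r k1 k1 + c2 ^+ 2 * bcoef r + c3 ^+ 2 * bcoef r.
  exact: dotp_lin.
rewrite dK in gK.
transitivity (\int[P]_w (rcos (J (win K) w + th))%:E)%E.
  apply: ge0_ae_eq_integral => //.
  - apply/measurable_EFinP; apply: (measurableT_comp measurable_rcos).
    apply: measurable_funD => //; apply: measurable_funD; last exact: measurable_funM.
    by apply: measurable_funD; exact: measurable_funM.
  - apply/measurable_EFinP; apply: (measurableT_comp measurable_rcos).
    exact: measurable_funD.
  - by move=> w _; rewrite lee_fin rcos_ge0.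
  - by move=> w _; rewrite lee_fin rcos_ge0.
  - apply: filterS (J_lin c1 c2 c3) => w Ew _; rewrite Ew; congr (rcos _)%:E.
    rewrite -[lapl w]/((beta r)^-1 * J (win k1) w).
    rewrite -[dx w]/((bcoef r)^-1 * J (win k2) w).
    rewrite -[dy w]/((bcoef r)^-1 * J (win k3) w).
    by rewrite /c1 /c2 /c3; ring.
rewrite (integral_gaussian_rcos th gK); congr (1 + _ * gaussian_char _)%:E.
rewrite -var_dx /lapl_var /c1 /c2 /c3.
by move: (beta r)^-1 (bcoef r)^-1 (bcoef r) (dotp r k1 k1) => bi ci c e; ring.
Qed.

Lemma noise_independent_grad A B : measurable A -> measurable B ->
  P (lapl @^-1` A `&` noise_grad J r u v @^-1` B) =
  (P (lapl @^-1` A) * (distribution P dx \x distribution P dy) B)%E.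
Proof.
have v0 : 0 <= grad_var by rewrite divr_ge0 ?sqr_ge0// ltW// bcoef_gt0.
have l0 : 0 <= lapl_var by case: lapl_gaussian.
exact: (gaussian_independent l0 v0 v0 (@gaussian_charD R) noise_char).
Qed.

End noise.

(** * The law of the gradient *)

Section gradient_law.
Context {R : realType} d {T : measurableType d} (P : probability T R).
Local Notation MR := (measurableTypeR R).

Lemma gaussian_pair_law (X Y : {mfun T >-> R}) (v : R) (D : set (R * R)) :
  v != 0 -> is_gaussian P X 0 v -> is_gaussian P Y 0 v -> measurable D ->
  (distribution P X \x distribution P Y)%E D = normal2 (Num.sqrt v) D.
Proof.
move=> v0 gX gY mD.
have Ydist x : distribution P Y (xsection D x) =
    normal_prob 0 (Num.sqrt v) (xsection D x).
  rewrite (gY.2 _ (measurable_xsection x mD)) /gaussian_law.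
  by rewrite (negbTE v0).
have mf : measurable_fun [set: R] (fun x : R => distribution P Y (xsection D x)).
  exact: (measurable_fun_xsection (distribution P Y) mD).
have f0 x : (0 <= distribution P Y (xsection D x))%E by exact: measure_ge0.
rewrite -[LHS]/(\int[distribution P X]_x distribution P Y (xsection D x))%E.
rewrite (ge0_integral_distribution _ mf f0).
rewrite -[LHS]/(\int[P]_w ((fun x : R => distribution P Y (xsection D x)) (X w)))%E.
rewrite (ge0_integral_gaussian gX mf f0) (negbTE v0).
rewrite -[RHS]/(\int[normal_prob 0 (Num.sqrt v)]_x normal_prob 0 (Num.sqrt v) (xsection D x))%E.
by apply: eq_integral => x _; exact: Ydist.
Qed.

Lemma measurable_sqn_gt_plane (t : R) : measurable [set z : R * R | t < sqn z].
Proof. exact: measurable_sqn_gt. Qed.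

Lemma enorm_gt (t : R) : 0 <= t ->
  [set z : R * R | t < enorm z] = [set z | t ^+ 2 < sqn z].
Proof.
move=> t0; apply/seteqP; split => z /=.
  by rewrite -(@ltr_pXn2r _ 2%N)// ?nnegrE ?sqrtr_ge0// sqr_sqrtr ?sqn_ge0.
by move=> tz; rewrite -(@ltr_pXn2r _ 2%N)// ?nnegrE ?sqrtr_ge0// sqr_sqrtr ?sqn_ge0.
Qed.

Lemma gaussian_pair_tail (X Y : {mfun T >-> R}) (v t : R) : 0 < v -> 0 <= t ->
  is_gaussian P X 0 v -> is_gaussian P Y 0 v ->
  (distribution P X \x distribution P Y)%E [set z | t < enorm z] =
  (expR (- ((2 * v)^-1 * t ^+ 2)))%:E.
Proof.
move=> v0 t0 gX gY; rewrite (enorm_gt t0).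
rewrite (gaussian_pair_law _ gX gY (measurable_sqn_gt_plane _)) ?gt_eqF//.
rewrite normal2_tail ?sqrtr_gt0// ?sqr_ge0// sqr_sqrtr//; exact: ltW.
Qed.

End gradient_law.

Section support.
Context {R : realType} d {T : measurableType d} (P : probability T R).
Local Notation MR := (measurableTypeR R).

(** An open set around 0 contains a symmetric interval, on which the density
    is bounded below by its value at the end points. *)
Lemma normal_prob_open_gt0 (s : R) (A : set R) : s != 0 -> open A -> A 0 ->
  (0 < normal_prob 0 s A)%E.
Proof.
move=> s0 oA A0.
have : \forall e \near (0 : R)^'+, `[- e, e] `<=` A.
  have [e/= e0 eA] := open_nbhs_nbhs (conj oA A0).
  near=> x => y; rewrite /= in_itv/= -ler_norml => yx.
  apply: eA; rewrite /= sub0r normrN; apply: le_lt_trans yx _.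
  by near: x; exact: nbhs_right_lt.
move=> nA.
have [e [e0 eA]] : exists e : R, 0 < e /\ `[- e, e] `<=` A.
  near (0 : R)^'+ => e; exists e; split; near: e; [exact: nbhs_right_gt|exact: nA].
pose I : set MR := [set` `[- e, e]].
have mI : measurable I by exact: measurable_itv.
have muI : lebesgue_measure I = (e + e)%:E.
  by rewrite /I lebesgue_measure_itv/= lte_fin gtrN// -EFinD opprK.
have mA : measurable A by exact: open_measurable.
apply: (@lt_le_trans _ _ (normal_prob 0 s I)); last first.
  by apply: le_measure; rewrite ?inE.
apply: (@lt_le_trans _ _ (\int[lebesgue_measure]_(x in I) (normal_pdf 0 s e)%:E)%E).
  rewrite integral_cst// [X in (_ * X)%E]muI.
  rewrite -EFinM lte_fin mulr_gt0 ?addr_gt0// normal_pdfE//.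
  by rewrite mulr_gt0 ?expR_gt0// normal_peak_gt0.
apply: ge0_le_integral => //.
- by move=> x _; rewrite lee_fin normal_pdf_ge0.
- by apply/measurable_funTS/measurable_EFinP; exact: measurable_normal_pdf.
move=> x xI; rewrite lee_fin !normal_pdfE// ler_wpM2l ?normal_peak_ge0//.
rewrite ler_expR !mulNr lerN2 ler_wpM2r ?invr_ge0 ?mulrn_wge0 ?sqr_ge0// !subr0.
rewrite -(real_normK (num_real x)) ler_pXn2r ?nnegrE ?(ltW e0)//.
by move: xI; rewrite /I /= in_itv/= -ler_norml.
Unshelve. all: by end_near. Qed.

(** Holds also for the point mass at 0, the case of variance 0. *)
Lemma gaussian_open_gt0 (X : {mfun T >-> R}) (v : R) (A : set R) :
  is_gaussian P X 0 v -> open A -> A 0 -> (0 < distribution P X A)%E.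
Proof.
move=> [v0 gX] oA A0; rewrite (gX _ (open_measurable oA)) /gaussian_law.
case: ifPn => [_|v0']; first by rewrite diracE mem_set.
by apply: normal_prob_open_gt0; rewrite // gt_eqF// sqrtr_gt0 lt_neqAle eq_sym v0'.
Qed.

End support.

(** * Continuous conditional laws under independence *)

Section ramp.
Context {R : realType}.

(** Rises from 0 to 1 as the norm goes from [a] to [b].  A continuous
    substitute for the indicators of the tails, which weak continuity
    does not control. *)
Definition ramp (a b : R) (z : R * R) : R :=
  Num.max 0 (Num.min 1 ((enorm z - a) / (b - a))).

Lemma continuous_enorm : continuous (@enorm R).
Proof.
move=> z; apply: (@continuous_comp _ _ _ (fun z : R * R => z.1 ^+ 2 + z.2 ^+ 2) (@Num.sqrt R)).
  by apply: cvgD; apply: cvgM; do [exact: cvg_fst|exact: cvg_snd].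
exact: sqrt_continuous.
Qed.

Lemma continuous_ramp a b : continuous (ramp a b).
Proof.
move=> z.
have cl : {for z, continuous (fun z => (enorm z - a) / (b - a) : R^o)}.
  apply: cvgMl; apply: cvgB; last exact: cvg_cst.
  exact: continuous_enorm.
have cm := continuous_min (@cst_continuous _ R^o (1 : R) z) cl.
exact: (continuous_max (@cst_continuous _ R^o (0 : R) z) cm).
Qed.

Lemma ramp_ge0 a b z : 0 <= ramp a b z.
Proof. by rewrite /ramp le_max lexx. Qed.

Lemma ramp_le1 a b z : ramp a b z <= 1.
Proof. by rewrite /ramp ge_max ler01 ge_min lexx. Qed.

Lemma ramp_eq1 a b z : a < b -> b <= enorm z -> ramp a b z = 1.
Proof.
move=> ab bz; rewrite /ramp min_l ?max_r// ler_pdivlMr ?subr_gt0//.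
by rewrite mul1r lerD2r.
Qed.

Lemma ramp_eq0 a b z : a < b -> enorm z <= a -> ramp a b z = 0.
Proof.
move=> ab bz; rewrite /ramp; apply: max_l; rewrite ge_min; apply/orP; right.
by rewrite ler_pdivrMr ?subr_gt0// mul0r subr_le0.
Qed.

Lemma measurable_enorm : measurable_fun [set: R * R] (@enorm R).
Proof.
apply: (measurableT_comp (continuous_measurable_fun (@sqrt_continuous R))).
exact: measurable_sqn.
Qed.

Lemma measurable_ramp a b : measurable_fun [set: R * R] (ramp a b).
Proof.
apply: measurable_maxr => //; apply: measurable_minr => //.
apply: measurable_funM => //; apply: measurable_funB => //.
exact: measurable_enorm.
Qed.

Lemma measurable_enorm_gt a : measurable [set z : R * R | a < enorm z].
Proof.
have -> : [set z : R * R | a < enorm z] = setT `&` @enorm R @^-1` `]a, +oo[.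
  by apply/seteqP; split => z /=; rewrite in_itv/= andbT// => -[].
by apply: measurable_enorm => //; exact: measurable_itv.
Qed.

Lemma measurable_enorm_ge a : measurable [set z : R * R | a <= enorm z].
Proof.
have -> : [set z : R * R | a <= enorm z] = setT `&` @enorm R @^-1` `[a, +oo[.
  by apply/seteqP; split => z /=; rewrite in_itv/= andbT// => -[].
by apply: measurable_enorm => //; exact: measurable_itv.
Qed.

Lemma ramp_sandwich (m : {measure set (R * R) -> \bar R}) a b :
  m [set: R * R] = 1%E -> a < b ->
  (m [set z | (b <= enorm z)%R] <= (\int[m]_z ramp a b z)%:E <=
   m [set z | (a < enorm z)%R])%E.
Proof.
move=> m1 ab.
have i_ind (A : set (R * R)) : measurable A -> m A = (\int[m]_z (\1_A z)%:E)%E.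
  by move=> mA; rewrite integral_indic// setIT.
have mram := measurable_ramp a b.
have EI : ((\int[m]_z ramp a b z)%:E = \int[m]_z (ramp a b z)%:E)%E.
  rewrite fineK// ge0_fin_numE; last first.
    by apply: integral_ge0 => z _; rewrite lee_fin ramp_ge0.
  apply: (@le_lt_trans _ _ (\int[m]_z (cst 1%E z))%E).
    apply: ge0_le_integral => //.
    - by move=> z _; rewrite lee_fin ramp_ge0.
    - exact/measurable_EFinP.
    - by move=> z _; rewrite lee_fin ramp_le1.
  by rewrite integral_cst// mul1e m1 ltry.
have mge := measurable_enorm_ge b; have mgt := measurable_enorm_gt a.
rewrite EI (i_ind _ mge) (i_ind _ mgt); apply/andP; split.
  apply: ge0_le_integral => //.
  - by apply/measurable_EFinP; exact: measurable_indic.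
  - exact/measurable_EFinP.
  - move=> z _; rewrite lee_fin indicE; case: (boolP (z \in _)); last by move=> _; exact: ramp_ge0.
    by rewrite inE => /= bz; rewrite ramp_eq1.
apply: ge0_le_integral => //.
- by move=> z _; rewrite lee_fin ramp_ge0.
- exact/measurable_EFinP.
- by apply/measurable_EFinP; exact: measurable_indic.
- move=> z _; rewrite lee_fin indicE; case: (boolP (z \in _)) => [_|]; first exact: ramp_le1.
  by rewrite notin_setE => /= /negP; rewrite -leNgt => za; rewrite ramp_eq0.
Qed.

End ramp.

Section conditional_law.
Context {R : realType} d {T : measurableType d} (P : probability T R).
Variables (X : {RV P >-> R}) (Y : T -> R * R) (nu : probability (R * R)%type R).
Hypothesis indep : forall A B, measurable A -> measurable B ->
  P (X @^-1` A `&` Y @^-1` B) = (P (X @^-1` A) * nu B)%E.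

(** Under independence conditioning changes nothing: the kernel constantly
    equal to [nu] is continuous and disintegrates the joint law. *)
Lemma continuous_cond_law_exists :
  exists kappa : R.-pker R ~> (R * R)%type, continuous_cond_law X Y kappa.
Proof.
have mnu : measurable_fun [set: R] (cst nu : R -> pprobability (R * R)%type R).
  exact: measurable_cst.
exists (kprobability mnu); split.
- move=> A B mA mB; rewrite indep//.
  by rewrite [RHS](integral_cst (distribution P X) mA (nu B)) muleC.
- by move=> f _ _; exact: (@cst_continuous R R (\int[nu]_z f z)).
Qed.

Hypothesis X_charges : forall A : set R, open A -> A 0 ->
  (0 < distribution P X A)%E.
Variable kappa : R.-pker R ~> (R * R)%type.
Hypothesis kappaE : continuous_cond_law X Y kappa.

(** If [h 0] exceeded [nu B], then [h] would stay above some [c > nu B] on a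
    neighbourhood [A] of 0.  Integrating [kappa t B >= c] over [A], which has
    positive probability, contradicts independence. *)
Lemma cond_law_le_of_continuous (h : R -> R) B : continuous h -> measurable B ->
  (forall t, ((h t)%:E <= kappa t B)%E) -> ((h 0)%:E <= nu B)%E.
Proof.
move=> ch mB hk; rewrite leNgt; apply/negP => nuh.
have nufin : nu B \is a fin_num by exact: fin_num_measure.
have q_lt : fine (nu B) < h 0 by rewrite -lte_fin fineK.
pose c := (fine (nu B) + h 0) / 2.
have c_lt : c < h 0 by rewrite /c; lra.
have q_c : fine (nu B) < c by rewrite /c; lra.
pose A : set R := h @^-1` `]c, +oo[.
have oA : open A by apply: open_comp => [t _|]; [exact: ch|exact: interval_open].
have mA : measurable A by exact: open_measurable.
have A0 : A 0 by rewrite /A /= in_itv/= c_lt.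
have XA := X_charges oA A0.
have XAfin : distribution P X A \is a fin_num by exact: fin_num_measure.
have : (c%:E * distribution P X A <= nu B * distribution P X A)%E.
  rewrite [leRHS]muleC -[leRHS](indep mA mB).
  rewrite (cond_law_disintegration kappaE mA mB).
  rewrite -(integral_cst (distribution P X) mA c%:E).
  apply: ge0_le_integral => //.
  - by move=> t _; rewrite lee_fin (le_trans _ (ltW q_c))// fine_ge0.
  - exact: measurable_funTS (measurable_kernel kappa B mB).
  - move=> t tA; apply: le_trans (hk t); rewrite lee_fin.
    by move: tA; rewrite /A /= in_itv/= andbT => /ltW.
by rewrite lee_pmul2r// -(fineK nufin) lee_fin leNgt q_c.
Qed.

Let kappaC t B : measurable B -> (kappa t B + kappa t (~` B) = 1)%E.
Proof.
move=> mB; have mB' : measurable (~` B) by exact: measurableC.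
by rewrite -(measureU (kappa t) mB mB') ?setICr// setUv; exact: (@prob_kernel _ _ _ _ _ kappa t).
Qed.

(** The previous lemma for the complement of [B] and [1 - h]. *)
Lemma cond_law_ge_of_continuous (h : R -> R) B : continuous h -> measurable B ->
  (forall t, (kappa t B <= (h t)%:E)%E) -> (nu B <= (h 0)%:E)%E.
Proof.
move=> ch mB hk; have mB' : measurable (~` B) by exact: measurableC.
have ch' : continuous (fun t => 1 - h t).
  by move=> t; apply: cvgB; [exact: cvg_cst|exact: ch].
have /(cond_law_le_of_continuous ch' mB') : forall t, ((1 - h t)%:E <= kappa t (~` B))%E.
  by move=> t; rewrite EFinB leeBlDl// -(kappaC t mB) leeD2r.
rewrite (@probability_setC _ _ _ nu _ mB) -(fineK (fin_num_measure nu B mB)).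
by rewrite -EFinB !lee_fin; lra.
Qed.

(** The integral of the ramp against [kappa t] is continuous in [t] and lies
    between the two tails; comparing each tail with [nu] loses an arbitrarily
    small change of radius. *)
Lemma cond_law_sandwich a b : a < b ->
  (kappa 0%R [set z | (b <= enorm z)%R] <= nu [set z | (a < enorm z)%R])%E /\
  (nu [set z | (b < enorm z)%R] <= kappa 0%R [set z | (a <= enorm z)%R])%E.
Proof.
move=> ab; pose h t := \int[kappa t]_z ramp a b z.
have ch : continuous h.
  apply: (cond_law_continuous kappaE); first exact: continuous_ramp.
  exists 1; split => // M M1 z _.
    by rewrite /= ger0_norm ?ramp_ge0// (le_trans (ramp_le1 _ _ _))// ltW.
have mge := @measurable_enorm_ge R; have mgt := @measurable_enorm_gt R.
have le_gt_ge (m : {measure set (R * R) -> \bar R}) c :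
    (m [set z | (c < enorm z)%R] <= m [set z | (c <= enorm z)%R])%E.
  apply: le_measure; rewrite ?inE; [exact: mgt|exact: mge|].
  by move=> x /=; exact: ltW.
split.
  have /andP[+ _] := ramp_sandwich (@prob_kernel _ _ _ _ _ kappa 0) ab.
  move=> /le_trans; apply; apply: (cond_law_le_of_continuous ch) => // t.
  by have /andP[] := ramp_sandwich (@prob_kernel _ _ _ _ _ kappa t) ab.
have /andP[_] := ramp_sandwich (@prob_kernel _ _ _ _ _ kappa 0) ab.
move=> /le_trans /(_ (le_gt_ge (kappa 0) a)); apply: le_trans.
apply: (le_trans (le_gt_ge nu b)).
apply: (cond_law_ge_of_continuous ch) => // t.
by have /andP[] := ramp_sandwich (@prob_kernel _ _ _ _ _ kappa t) ab.
Qed.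

End conditional_law.

(** * The threshold *)

Section threshold.
Context {R : realType} (Q : set (R * R) -> \bar R) (k eps : R).
Hypotheses (k0 : 0 < k) (eps0 : 0 < eps) (eps1 : eps < 1).
Hypothesis Q_le : forall a b, 0 <= a < b ->
  (Q [set z | (b <= enorm z)%R] <= (expR (- (k * a ^+ 2)))%:E)%E.
Hypothesis Q_ge : forall a b, 0 <= a < b ->
  ((expR (- (k * b ^+ 2)))%:E <= Q [set z | (a <= enorm z)%R])%E.

Let s0 := Num.sqrt (- (k^-1 * ln eps)).

Let c0 : 0 < - (k^-1 * ln eps).
Proof. by rewrite -mulrN mulr_gt0 ?invr_gt0// oppr_gt0 ln_lt0// eps0. Qed.

Let s0_gt0 : 0 < s0. Proof. by rewrite sqrtr_gt0. Qed.

Let s0_sqr : k * s0 ^+ 2 = - ln eps.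
Proof. by rewrite sqr_sqrtr ?(ltW c0)// mulrN mulVKf// gt_eqF. Qed.

Let eps_lt b : 0 <= b < s0 -> eps < expR (- (k * b ^+ 2)).
Proof.
move=> /andP[b0 bs]; rewrite -{1}(lnK eps0) ltr_expR ltrNr -s0_sqr ltr_pM2l//.
by rewrite ltr_pXn2r ?nnegrE// ltW.
Qed.

Let Q_s0 : (Q [set z | (s0 <= enorm z)%R] <= eps%:E)%E.
Proof.
apply/lee_addgt0Pr => e e0.
pose f (a : R) := expR (- (k * a ^+ 2)).
have cf : continuous f.
  move=> x; apply: (@continuous_comp _ _ _ (fun a : R => - (k * a ^+ 2)) expR).
    by apply: cvgN; apply: cvgMr; exact: exprn_continuous.
  exact: continuous_expR.
have fs0 : f s0 = eps by rewrite /f s0_sqr opprK lnK.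
(* [s0] is approached from below, where [Q_le] bounds the tail at [s0]. *)
have nf : \forall a \near s0^'-, f a < eps + e.
  by apply: cvg_within; apply: (cvgr_lt (f s0) (cf s0)); rewrite fs0 ltrDl.
have [a [a_s0 fa]] : exists a, 0 <= a < s0 /\ f a < eps + e.
  near s0^'- => a; exists a; split; last by near: a; exact: nf.
  by apply/andP; split; near: a; [exact: nbhs_left_ge|exact: nbhs_left_lt].
by apply: le_trans (Q_le a_s0) _; rewrite -EFinD lee_fin ltW.
Unshelve. all: by end_near. Qed.

(** Bounds at neighbouring radii suffice, the exponential being continuous:
    the tail of [Q] is above [eps] at every radius less than the threshold,
    and at the threshold it is at most every value of the exponential at a
    smaller radius. *)
Lemma threshold_gaussian_tail s :
  is_threshold Q eps s <-> s = Num.sqrt (- (k^-1 * ln eps)).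
Proof.
have lb : lbound [set t : R | 0 <= t /\
    (Q [set z | (t <= enorm z)%R] <= eps%:E)%E] s0.
  move=> t [t0 Qt]; rewrite leNgt; apply/negP => ts.
  pose b := (t + s0) / 2.
  have tb : t < b by rewrite /b; lra.
  have bs : b < s0 by rewrite /b; lra.
  have tb' : 0 <= t < b by rewrite t0 tb.
  have := le_trans (Q_ge tb') Qt.
  by rewrite lee_fin leNgt eps_lt// bs (le_trans t0 (ltW tb)).
split => [[[t0 Qs] ls]|->].
  by apply/le_anti; rewrite lb// andbT; apply: ls; split => //; exact: ltW.
by split => //; split => //; exact: ltW.
Qed.

End threshold.

Unset Implicit Arguments.
Set Printing Implicit Defensive.

Theorem proposition1 (R : realType) (d : measure_display)
    (T : measurableType d) (P : probability T R)
    (r sigma eps u v : R)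
    (W : set (R * R) -> {RV P >-> R}) (J : (R * R -> R) -> {RV P >-> R})
    (r_gt0 : 0 < r) (sigma_gt0 : 0 < sigma) (eps_gt0 : 0 < eps)
    (eps_lt1 : eps < 1)
    (noiseW : gaussian_white_noise sigma W)
    (wienerJ : wiener_integral sigma W J) :
  (exists kappa : R.-pker R ~> (R * R)%type,
     continuous_cond_law (noise_lapl J r u v) (noise_grad J r u v) kappa) /\
  (forall kappa : R.-pker R ~> (R * R)%type,
     continuous_cond_law (noise_lapl J r u v) (noise_grad J r u v) kappa ->
     forall s : R, is_threshold (kappa 0) eps s <->
       s = Num.sqrt (- (2 * sigma ^+ 2 / bcoef r) * ln eps)).
Proof.
pose q := grad_var sigma r.
have q0 : 0 < q by rewrite divr_gt0 ?exprn_gt0 ?(bcoef_gt0 r_gt0).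
have gx := dx_gaussian wienerJ u v r_gt0.
have gy := dy_gaussian wienerJ u v r_gt0.
pose nu : probability (R * R)%type R :=
  (distribution P (noise_dx J r u v) \x distribution P (noise_dy J r u v))%E.
have indep A B : measurable A -> measurable B ->
    P (noise_lapl J r u v @^-1` A `&` noise_grad J r u v @^-1` B) =
    (P (noise_lapl J r u v @^-1` A) * nu B)%E.
  exact: (noise_independent_grad wienerJ u v r_gt0).
split; first exact: (continuous_cond_law_exists indep).
move=> kappa kappaE s.
have nuE t : 0 <= t -> nu [set z | t < enorm z] = (expR (- ((2 * q)^-1 * t ^+ 2)))%:E.
  by move=> t0; exact: (gaussian_pair_tail q0 t0 gx gy).
have charges (A : set R) : open A -> A 0 ->
    (0 < distribution P (noise_lapl J r u v) A)%E.
  exact: (gaussian_open_gt0 (lapl_gaussian wienerJ u v r_gt0)).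
have -> : 2 * sigma ^+ 2 / bcoef r = (2 * q)^-1^-1.
  by rewrite invrK /q /grad_var mulrA.
rewrite mulNr; apply: threshold_gaussian_tail => //.
- by rewrite invr_gt0 mulr_gt0.
- move=> a b /andP[a0 ab].
  have [+ _] := cond_law_sandwich indep charges kappaE ab.
  by rewrite nuE.
- move=> a b /andP[a0 ab].
  have [_] := cond_law_sandwich indep charges kappaE ab.
  by rewrite nuE// (le_trans a0 (ltW ab)).
Qed.
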